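(* Let $n\geq 3$ and $\delta\in[0,1]$, or $n=2$ and $\delta\in[0,1)$. Then the singularized Hermite projection kernels $\left\{\frac{\Phi_k(x,y)}{|x|^{\delta}}\right\}_{k\geq 0}$ map $L^2(\mathbb{R}^n)$ to $L^2(\mathbb{R}^n)$ uniformly in $k$: there exists $C>0$ depending only on $\delta$ and $n$ such that for all integers $k\geq 0$ and all $f\in L^2(\mathbb{R}^n)$, $$ \left\|\int_{\mathbb{R}^n}\frac{\Phi_k(\cdot,y)}{|\cdot|^{\delta}}f(y)\,dy\right\|_2\leq C\|f\|_2 . $$ Moreover, the more singular family of kernels $\left\{\frac{\Phi_k(x,y)}{|x|^{\delta}|y|^{\delta}}\right\}_{k\geq 0}$ also maps $L^2(\mathbb{R}^n)$ to $L^2(\mathbb{R}^n)$ uniformly in $k$.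
   Context: For an $n$-multiindex $\alpha$ of nonnegative integers with $|\alpha|=\alpha_1+\dots+\alpha_n$, let $\Phi_\alpha(x)=\prod_{i=1}^n h_{\alpha_i}(x_i)$, where $h_m(t)=\frac{(-1)^m}{(2^m m!\sqrt{\pi})^{1/2}}e^{t^2/2}\frac{d^m}{dt^m}(e^{-t^2})$, $t\in\mathbb{R}$, are the normalized one-dimensional Hermite functions. The Hermite projection kernel is $\Phi_k(x,y)=\sum_{|\alpha|=k}\Phi_\alpha(x)\Phi_\alpha(y)$, $x,y\in\mathbb{R}^n$; it is the kernel of the orthogonal projection onto the eigenspace of $-\triangle+|x|^2$ with eigenvalue $2k+n$. $\|\cdot\|_2$ is the norm of $L^2(\mathbb{R}^n)$. *)

(* Defs.v *)
From HB Require Import structures.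
From mathcomp Require Import all_boot all_order all_algebra complex.
From mathcomp Require Import all_classical all_reals all_analysis.

Set Implicit Arguments.
Unset Strict Implicit.
Unset Printing Implicit Defensive.
Import Order.TTheory GRing.Theory Num.Theory.
Import numFieldNormedType.Exports.

Local Open Scope classical_set_scope.
Local Open Scope ring_scope.

(* R^n, with the product (Borel) sigma-algebra that tuples carry. *)
Notation euclidean R n := (n.-tuple (measurableTypeR R)).

Section lebesgue_cons.
Context (R : realType) (n : nat).
Variable mu : {sigma_finite_measure set (euclidean R n) -> \bar R}.

Definition cons_pair (z : measurableTypeR R * euclidean R n) :
    euclidean R n.+1 :=
  [the n.+1.-tuple (measurableTypeR R) of z.1 :: z.2].

Lemma measurable_cons_pair : measurable_fun setT cons_pair.
Proof. exact: measurable_cons. Qed.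

(* The product of one-dimensional Lebesgue measure and mu, carried over from
   R * R^n to R^(n+1). *)
Definition lebesgue_cons : set (euclidean R n.+1) -> \bar R :=
  pushforward (@lebesgue_measure R \x mu)%E cons_pair.

Let pushforward_measure : {measure set (euclidean R n.+1) -> \bar R} :=
  measure_function_pushforward__canonical__measure_function_Measure
    (@lebesgue_measure R \x mu)%E measurable_cons_pair.

HB.instance Definition _ := isMeasure.Build _ _ _ lebesgue_cons
  (measure0 pushforward_measure) (measure_ge0 pushforward_measure)
  (@measure_semi_sigma_additive _ _ _ pushforward_measure).

Lemma lebesgue_consE (A : set R) (B : set (euclidean R n)) :
  measurable A -> measurable B ->
  lebesgue_cons [set x | A (tnth x ord0) /\ B [tuple of behead x]] =
  (lebesgue_measure A * mu B)%E.
Proof.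
move=> mA mB; rewrite -product_measure1E//; congr (product_measure1 _ _ _).
apply/seteqP; split=> [[a t]|[a t]] /=.
  rewrite /cons_pair/= => -[Aa Bt]; split=> //=.
  rewrite (_ : t = [tuple of behead
    [the n.+1.-tuple (measurableTypeR R) of a :: t]])//.
  exact/val_inj.
move=> [/= Aa Bt]; split=> //; rewrite (_ : [tuple of _] = t)//.
exact/val_inj.
Qed.

Lemma lebesgue_cons_sigma_finite : sigma_finite setT lebesgue_cons.
Proof.
have /sigma_finiteP[F [TF ndF Foo]] := sigma_finiteT (@lebesgue_measure R).
have /sigma_finiteP[G [TG ndG Goo]] := sigma_finiteT mu.
pose FG i := [set x : euclidean R n.+1 |
  F i (tnth x ord0) /\ G i [tuple of behead x]].
exists FG.
  apply/esym; rewrite -subTset => x _.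
  have : setT (tnth x ord0) by []. rewrite TF => -[i _ Fi].
  have : setT [tuple of behead x] by []. rewrite TG => -[j _ Gj].
  exists (maxn i j) => //; split.
    by move: Fi; exact/subsetPset/ndF/leq_maxl.
  by move: Gj; exact/subsetPset/ndG/leq_maxr.
move=> i; have [mF Fi] := Foo i; have [mG Gi] := Goo i; split.
  apply: measurableI.
    by rewrite -[X in measurable X]setTI; exact: measurable_tnth.
  by rewrite -[X in measurable X]setTI; exact: measurable_behead.
by rewrite lebesgue_consE// lte_mul_pinfty// ge0_fin_numE.
Qed.

HB.instance Definition _ := Measure_isSigmaFinite.Build _ _ _
  lebesgue_cons lebesgue_cons_sigma_finite.

End lebesgue_cons.

Fixpoint lebesgueN (R : realType) (n : nat) :
    {sigma_finite_measure set (euclidean R n) -> \bar R} :=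
  match n with
  | 0 => dirac ([tuple] : euclidean R 0)
  | m.+1 => lebesgue_cons (lebesgueN R m)
  end.

Lemma lebesgueN_box (R : realType) (n : nat) (A : 'I_n -> set R) :
  (forall i, measurable (A i)) ->
  lebesgueN R n [set x | forall i, A i (tnth x i)] =
  (\prod_(i < n) lebesgue_measure (A i))%E.
Proof.
elim: n A => [|n IHn] A mA.
  by rewrite big_ord0 /= diracE mem_set// => -[].
rewrite big_ord_recl -IHn; last by move=> i; exact: mA.
rewrite -lebesgue_consE//.
  rewrite /=; congr (lebesgue_cons (lebesgueN R n) _).
  apply/seteqP; split=> x /=.
    move=> Ax; split=> // i; move: (Ax (lift ord0 i)).
    by rewrite [in tnth x _](tuple_eta x) tnthS.
  move=> [A0 AS] i; case: (unliftP ord0 i) => [j ->|->//].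
  by rewrite (tuple_eta x) tnthS.
rewrite (_ : [set _ | _] = \bigcap_(i in [set: 'I_n])
    ((fun x : euclidean R n => tnth x i) @^-1` A (lift ord0 i))).
  apply: fin_bigcap_measurable => // i _.
  rewrite -[X in measurable X]setTI.
  exact: (@measurable_tnth _ (measurableTypeR R) n i measurableT _ (mA _)).
by apply/seteqP; split=> x /= Hx i; [move=> _|]; exact: Hx.
Qed.

Section hermite.
Context {R : realType}.

Definition hermite_fun (m : nat) (t : R) : R :=
  (-1) ^+ m / Num.sqrt (2 ^+ m * m`!%:R * Num.sqrt pi) *
  expR (t ^+ 2 / 2) * derive1n m (fun s : R => expR (- s ^+ 2)) t.

Definition hermite_multi (n : nat) (a : 'I_n -> nat) (x : euclidean R n) : R :=
  \prod_(i < n) hermite_fun (a i) (tnth x i).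

(* Multiindices of length k have all their entries at most k, so they are the
   a : {ffun 'I_n -> 'I_k.+1} with entries summing to k. *)
Definition hermite_kernel (n k : nat) (x y : euclidean R n) : R :=
  \sum_(a : {ffun 'I_n -> 'I_k.+1} | (\sum_(i < n) a i)%N == k)
    hermite_multi (fun i => a i) x * hermite_multi (fun i => a i) y.

Definition enorm (n : nat) (x : euclidean R n) : R :=
  Num.sqrt (\sum_(i < n) tnth x i ^+ 2).

End hermite.

Section L2.
Context {R : realType} {n : nat}.
Let mu := lebesgueN R n.
Implicit Types (f : euclidean R n -> R[i]).
Implicit Types (K : euclidean R n -> euclidean R n -> R).

Definition L2norm f : \bar R :=
  Lnorm mu 2%:E (fun x => (Normc.normc (f x))%:E).

Definition L2 f : Prop :=
  [/\ measurable_fun setT (fun x => complex.Re (f x)),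
      measurable_fun setT (fun x => complex.Im (f x)) &
      (L2norm f < +oo)%E].

(* K is real-valued, so K x y * f y has real part K x y * Re (f y) and imaginary
   part K x y * Im (f y). *)
Definition kernel_op K f (x : euclidean R n) : R[i] :=
  Complex (\int[mu]_y (K x y * complex.Re (f y)))
          (\int[mu]_y (K x y * complex.Im (f y))).

(* Rintegral is 0 on non-integrable functions, so the convergence of the
   integral is part of the claim that the operator is defined on L^2. *)
Definition L2_bounded_by K (C : R) : Prop :=
  forall f, L2 f ->
  [/\ {ae mu, forall x,
        mu.-integrable setT (fun y => (K x y * complex.Re (f y))%:E) /\
        mu.-integrable setT (fun y => (K x y * complex.Im (f y))%:E)},
      L2 (kernel_op K f) &
      (L2norm (kernel_op K f) <= C%:E * L2norm f)%E].

Definition uniformly_L2_bounded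
    (K : nat -> euclidean R n -> euclidean R n -> R) : Prop :=
  exists2 C : R, 0 < C & forall k, L2_bounded_by (K k) C.

End L2.

(* Main.v *)
(* Write P_k for the projection onto the k-th eigenspace.  A bound
   int |g|^2 |x|^(-2 delta) <= C |g|^2, uniform in k and in g in the range of P_k,
   gives both claims: the first kernel is |x|^(-delta) P_k, and the second one is
   |x|^(-delta) P_k composed with its adjoint.

   The point is that in dimension 2 the diagonal value Phi_k(0,0) is bounded (it is
   1/pi or 0), since q_a = h_a(0)^2 satisfies (a+2) q_(a+2) = (a+1) q_a and hence
   sum_(a+b=k) q_a q_b does not grow with k.
   - n = 2: Sonin's monotone function propagates the bound to Phi_k(x,x) for x in
     the square |x_i| <= 1, where |x|^(-2 delta) is integrable.
   - n = 3: the kernel restricted to a line through the origin is, by rotation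
     invariance, sum_a h_a(t) h_a(s) Phi_(k-a)(0,0) with two-dimensional
     Phi_(k-a)(0,0), so restriction to lines is bounded on the range of P_k by T T*.
     Averaging over the directions produces the weight |x|^(-2).
   - n > 3: the weight only increases when a variable is dropped, and for a weight
     independent of a variable the estimate decouples by orthonormality of the
     Hermite functions in that variable. *)

Require Import Defs.
From mathcomp Require Import all_boot all_order all_algebra.
From mathcomp Require Import ring lra.
From mathcomp Require Import all_classical all_reals all_analysis measurable_realfun.
Import Order.TTheory GRing.Theory Num.Theory.
Import numFieldNormedType.Exports.

Set Implicit Arguments.
Unset Strict Implicit.
Unset Printing Implicit Defensive.

Local Open Scope classical_set_scope.
Local Open Scope ring_scope.

(** * One-dimensional Hermite functions *)

Section hermite_functions.
Context {R : realType}.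
Implicit Types (m n k : nat) (t : R).

(** For even k the diagonal value Phi_k(0,0) of dimension n has order k^(n/2-1), and this dictates
    the split. In dimension 3 a pointwise bound of Phi_k(x,x) near the origin loses a factor sqrt k.
    On a line of R^n what survives is the diagonal value of dimension n-1, which stays bounded only
    up to n = 3. In dimension 2 the restriction to lines would be bounded as well, but averaging it
    yields only the weight |x|^(-1), that is delta = 1/2; hence the pointwise argument there, which
    stops short of delta = 1 because |x|^(-2) is not integrable at the origin of the plane. Elements
    of the range of P_k are represented by their finite families of coefficients, the square sum of
    the coefficients playing the role of the squared norm. Each duality step is then a single
    expanded square such as |P c - b|^2 >= 0, which yields the operator bound without dividing by a
    norm that might vanish. *)

Fixpoint hermite_poly m : {poly R} :=
  if m is m'.+1 then 2 *: ('X * hermite_poly m') - (hermite_poly m')^`()%R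
  else 1.

(** This turns the defining relation of [hermite_poly] into the three-term recurrence. At m = 0 the
    index [m.-1] is again 0 but its coefficient vanishes; the ladder formulas below follow the same
    convention. *)
Lemma deriv_hermite_poly m :
  (hermite_poly m)^`()%R = (2 * m%:R) *: hermite_poly m.-1.
Proof.
elim: m => [|m IH]; first by rewrite /= derivC mulr0 scale0r.
rewrite [hermite_poly _]/= derivB derivZ derivM derivX mul1r IH derivZ.
case: m IH => [|m] _.
  by rewrite /= mulr0 scale0r mulr0 addr0 scale0r subr0 mulr1.
set P := hermite_poly m.+1; have -> : P = 2 *: ('X * hermite_poly m)
  - (hermite_poly m)^`()%R by [].
rewrite /= -!mul_polyC !rmorphM /=.
rewrite !rmorph_nat -[m.+2%:R]natr1.
by ring.
Qed.

Lemma hermite_polyS m :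
  hermite_poly m.+1 = 2 *: ('X * hermite_poly m) - (2 * m%:R) *: hermite_poly m.-1.
Proof. by rewrite /= deriv_hermite_poly. Qed.

Lemma is_derive_gauss t :
  is_derive t 1 (fun s : R => expR (- s ^+ 2)) (- (2 * t) * expR (- t ^+ 2)).
Proof.
have H : is_derive t 1 (fun s : R => - s ^+ 2) (- (2 * t)).
  have -> : (fun s : R => - s ^+ 2) = - (id ^+ 2) by apply/funext.
  by apply: is_derive_eq; rewrite /= /GRing.scale /=; ring.
have := @is_derive1_comp _ expR (fun s : R => - s ^+ 2) t _ _
  (is_derive_expR _) H.
by rewrite mulrC.
Qed.

Lemma derive1n_gauss m t :
  derive1n m (fun s : R => expR (- s ^+ 2)) t =
  (-1) ^+ m * (hermite_poly m).[t] * expR (- t ^+ 2).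
Proof.
elim: m t => [|m IH] t; first by rewrite /= hornerC; ring.
rewrite derive1nS (_ : derive1n m _ = fun t => (-1) ^+ m * (hermite_poly m).[t] *
   expR (- t ^+ 2)); last exact/funext.
rewrite derive1E.
have := is_derive_gauss t => H1.
have H2 := is_derive_poly (hermite_poly m) t.
have -> : (fun t => (-1) ^+ m * (hermite_poly m).[t] * expR (- t ^+ 2)) =
  (-1) ^+ m \*: (horner (hermite_poly m) * (fun s : R => expR (- s ^+ 2))).
  by apply/funext => s /=; rewrite /GRing.scale /= mulrA.
rewrite derive_val /GRing.scale /= !(hornerZ, hornerD, hornerN, hornerM, hornerX).
rewrite (exprS _ m); by ring.
Qed.

Definition hermite_coef m : R := (Num.sqrt (2 ^+ m * m`!%:R * Num.sqrt pi))^-1.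

Lemma hermite_coef_gt0 m : 0 < hermite_coef m.
Proof.
rewrite invr_gt0 sqrtr_gt0 !mulr_gt0 ?exprn_gt0 ?ltr0n ?fact_gt0//.
by rewrite sqrtr_gt0 pi_gt0.
Qed.

Lemma hermite_funE m t : hermite_fun m t =
  hermite_coef m * (hermite_poly m).[t] * expR (- (t ^+ 2 / 2)).
Proof.
rewrite /hermite_fun derive1n_gauss -/(hermite_coef m).
have -> : expR (- (t ^+ 2 / 2)) = expR (t ^+ 2 / 2) * expR (- t ^+ 2).
  by rewrite -expRD; congr expR; field.
have : (-1) ^+ m * (-1) ^+ m = 1 :> R by rewrite -exprMn mulrNN mulr1 expr1n.
move=> H.
transitivity (((-1) ^+ m * (-1) ^+ m) * (hermite_coef m * (hermite_poly m).[t]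
  * (expR (t ^+ 2 / 2) * expR (- t ^+ 2)))); last by rewrite H mul1r.
rewrite -[RHS]mulrA; by ring.
Qed.

Lemma hermite_coefS m :
  hermite_coef m = Num.sqrt (2 * m.+1%:R) * hermite_coef m.+1.
Proof.
rewrite /hermite_coef exprS factS natrM.
have -> : 2 * 2 ^+ m * (m.+1%:R * m`!%:R) * Num.sqrt pi =
  (2 * m.+1%:R) * (2 ^+ m * m`!%:R * Num.sqrt pi) :> R by ring.
have p : 0 <= 2 * m.+1%:R :> R by rewrite mulr_ge0.
rewrite (sqrtrM _ p) invfM mulrA divff ?mul1r// gt_eqF// sqrtr_gt0 mulr_gt0//.
Qed.

Let sqrtE (a : R) : 0 <= a -> Num.sqrt (2 * a) = 2 * Num.sqrt (a / 2).
Proof.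
move=> a0; rewrite {1}(_ : 2 * a = 2 ^+ 2 * (a / 2)); last by field.
by rewrite sqrtrM ?sqrtr_sqr ?ger0_norm// sqr_ge0.
Qed.

Lemma mulx_hermite_fun m t : t * hermite_fun m t =
  Num.sqrt (m%:R / 2) * hermite_fun m.-1 t +
  Num.sqrt (m.+1%:R / 2) * hermite_fun m.+1 t.
Proof.
rewrite !hermite_funE hermite_polyS hermite_coefS sqrtE//.
case: m => [|m].
  rewrite /= !(hornerZ, hornerD, hornerN, hornerM, hornerX, hornerC) mul0r sqrtr0; ring.
rewrite !(hornerZ, hornerD, hornerN, hornerM, hornerX) [m.+1.-1]/= (hermite_coefS m) (hermite_coefS m.+1) !sqrtE//.
(* The integer is traded for the square of its root, so that the goal becomes an algebraic identity
   in that root. *)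
have -> : 2 * m.+1%:R = 4 * Num.sqrt (m.+1%:R / 2) ^+ 2 :> R.
  by rewrite sqr_sqrtr ?divr_ge0//; field.
by field.
Qed.

(** Multiplication by t and d/dt are the sum and the difference of the same two ladder terms.
    Orthogonality, the recurrence at the origin and the rotation identity are read off from these
    two formulas. *)
Global Instance is_derive_hermite_fun m t : is_derive t 1 (hermite_fun m)
  (Num.sqrt (m%:R / 2) * hermite_fun m.-1 t -
   Num.sqrt (m.+1%:R / 2) * hermite_fun m.+1 t).
Proof.
have H : is_derive t 1 (fun s : R => - (s ^+ 2 / 2)) (- t).
  have -> : (fun s : R => - (s ^+ 2 / 2)) = - (2^-1 \*: (id ^+ 2)).
    by apply/funext => s; rewrite /= /GRing.scale /= mulrC.
  by apply: is_derive_eq; rewrite /= /GRing.scale /=; field.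
have He := @is_derive1_comp _ expR (fun s : R => - (s ^+ 2 / 2)) t _ _
  (is_derive_expR _) H.
have Hp := is_derive_poly (hermite_poly m) t.
have -> : hermite_fun m = hermite_coef m \*: (horner (hermite_poly m) *
   (expR \o (fun s : R => - (s ^+ 2 / 2)))).
  by apply/funext => s; rewrite hermite_funE /= /GRing.scale /= -mulrA.
apply: is_derive_eq; rewrite /GRing.scale /=.
have -> : Num.sqrt (m%:R / 2) * hermite_fun m.-1 t -
   Num.sqrt (m.+1%:R / 2) * hermite_fun m.+1 t =
   2 * (Num.sqrt (m%:R / 2) * hermite_fun m.-1 t) - t * hermite_fun m t.
  by rewrite mulx_hermite_fun; ring.
rewrite deriv_hermite_poly !hermite_funE.
case: m Hp => [|m] Hp.
  by rewrite /= !(hornerZ, hornerD, hornerN, hornerM, hornerX, hornerC) mul0r sqrtr0; ring.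
rewrite !(hornerZ, hornerD, hornerN, hornerM, hornerX) [m.+1.-1]/= (hermite_coefS m) !sqrtE//.
have -> : 2 * m.+1%:R = 4 * Num.sqrt (m.+1%:R / 2) ^+ 2 :> R.
  by rewrite sqr_sqrtr ?divr_ge0//; field.
by ring.
Qed.

End hermite_functions.

(** * Gaussian decay and integrals of derivatives *)

Section gaussian_decay.
Context {R : realType}.
Implicit Types (m n k : nat) (t : R) (f g F : R -> R).
Local Notation mu := (@lebesgue_measure R).

(** The rate e is arbitrary so that the induction on p can halve it: one half absorbs the polynomial
    of lower degree, the other half the new factor t. *)
Lemma horner_le_expR (p : {poly R}) (e : R) : 0 < e ->
  exists2 C, 0 <= C & forall t, `|p.[t]| <= C * expR (e * t ^+ 2).
Proof.
move=> e0; elim/poly_ind: p e e0 => [|p c IH] e e0.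
  by exists 0 => // t; rewrite horner0 normr0 mul0r.
have [C C0 HC] := IH _ (divr_gt0 e0 (ltr0n R 2)).
(* The factor 1 + 2/e comes from |t| <= 1 + t^2 <= (1 + 2/e) (1 + e t^2 / 2). *)
exists (C * (1 + 2 / e) + `|c|).
  by rewrite addr_ge0// mulr_ge0// addr_ge0// divr_ge0// ltW.
move=> t; rewrite hornerD hornerM hornerX hornerC.
apply: (le_trans (ler_normD _ _)); rewrite normrM mulrDl lerD//; last first.
  by rewrite ler_peMr// -expR0 ler_expR; apply: mulr_ge0; [exact: ltW|exact: sqr_ge0].
rewrite (_ : e * t ^+ 2 = e / 2 * t ^+ 2 + e / 2 * t ^+ 2); last by field.
rewrite expRD.
have e20 : 0 <= 2 / e by rewrite divr_ge0// ltW.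
have Ht : `|t| <= (1 + 2 / e) * expR (e / 2 * t ^+ 2).
  apply: (@le_trans _ _ ((1 + 2 / e) * (1 + e / 2 * t ^+ 2))); last first.
    by rewrite ler_wpM2l ?addr_ge0// expR_ge1Dx.
  have -> : (1 + 2 / e) * (1 + e / 2 * t ^+ 2) =
    1 + t ^+ 2 + (2 / e + e / 2 * t ^+ 2).
    by field; rewrite gt_eqF.
  apply: (@le_trans _ _ (1 + t ^+ 2)).
    by rewrite -(real_normK (num_real t)); have := normr_ge0 t; nra.
  by rewrite lerDl; apply: addr_ge0 => //; apply: mulr_ge0; [rewrite divr_ge0// ltW|exact: sqr_ge0].
apply: le_trans (ler_pM _ _ (HC t) Ht) _ => //.
by rewrite le_eqVlt; apply/orP; left; apply/eqP; ring.
Qed.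

Lemma hermite_fun_decay m :
  exists2 C, 0 <= C & forall t, `|hermite_fun m t| <= C * expR (- (t ^+ 2 / 4)).
Proof.
have [C C0 HC] := @horner_le_expR (hermite_poly m) 4^-1 ltac:(lra).
exists (hermite_coef m * C) => [|t].
  by rewrite mulr_ge0// ltW// hermite_coef_gt0.
rewrite hermite_funE !normrM (gtr0_norm (hermite_coef_gt0 _)).
rewrite (gtr0_norm (expR_gt0 _)) -[leLHS]mulrA -[leRHS]mulrA ler_wpM2l ?(ltW (hermite_coef_gt0 _))//.
rewrite (_ : - (t ^+ 2 / 4) = 4^-1 * t ^+ 2 + (- (t ^+ 2 / 2))); last by field.
by rewrite expRD mulrA ler_wpM2r ?expR_ge0.
Qed.

Lemma continuous_hermite_fun m : continuous (@hermite_fun R m).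
Proof.
by move=> t; apply: differentiable_continuous; apply/derivable1_diffP;
  have [] := is_derive_hermite_fun m t.
Qed.

(** The rate 1/4 is half of the rate of the Hermite functions: the other half pays for the
    polynomial factor, and a product of two members is dominated by exp(-t^2/2), the normal density
    up to a constant. *)
Definition gauss_decay f := measurable_fun setT f /\
  exists2 C, 0 <= C & forall t, `|f t| <= C * expR (- (t ^+ 2 / 4)).

Lemma gauss_decay_hermite m : gauss_decay (hermite_fun m).
Proof.
split; last exact: hermite_fun_decay.
exact: continuous_measurable_fun (@continuous_hermite_fun m).
Qed.

Lemma gauss_decay0 : gauss_decay (fun=> 0).
Proof. by split=> //; exists 0 => // t; rewrite normr0 mul0r. Qed.

Lemma gauss_decayD f g : gauss_decay f -> gauss_decay g ->
  gauss_decay (fun t => f t + g t).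
Proof.
move=> [mf [C C0 HC]] [mg [D D0 HD]]; split; first exact: measurable_funD.
exists (C + D) => [|t]; first exact: addr_ge0.
by rewrite (le_trans (ler_normD _ _))// mulrDl lerD.
Qed.

Lemma gauss_decayZ (c : R) f : gauss_decay f -> gauss_decay (fun t => c * f t).
Proof.
move=> [mf [C C0 HC]]; split; first exact: measurable_funM.
exists (`|c| * C) => [|t]; first exact: mulr_ge0.
by rewrite normrM -mulrA ler_wpM2l.
Qed.

Lemma gauss_decay_sum (I : Type) (r : seq I) (P : pred I) (F : I -> R -> R) :
  (forall i, gauss_decay (F i)) -> gauss_decay (fun t => \sum_(i <- r | P i) F i t).
Proof.
move=> HF; elim: r => [|i r IH].
  by under eq_fun do rewrite big_nil; exact: gauss_decay0.
under eq_fun do rewrite big_cons.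
by case: (P i) => //; exact: gauss_decayD.
Qed.

Lemma gauss_decay_mul f g : gauss_decay f -> gauss_decay g ->
  measurable_fun setT (fun t => f t * g t) /\
  exists2 C, 0 <= C & forall t, `|f t * g t| <= C * expR (- (t ^+ 2 / 2)).
Proof.
move=> [mf [C C0 HC]] [mg [D D0 HD]]; split; first exact: measurable_funM.
exists (C * D) => [|t]; first exact: mulr_ge0.
rewrite normrM (_ : - (t ^+ 2 / 2) = - (t ^+ 2 / 4) + - (t ^+ 2 / 4)); last by field.
by rewrite expRD mulrACA ler_pM.
Qed.

Lemma integrable_expR_half :
  mu.-integrable setT (fun t => (expR (- (t ^+ 2 / 2)))%:E).
Proof.
have := @integrable_normal_pdf R 0 1 => /(integrableZl measurableT (normal_peak 1)^-1).
apply: eq_integrable => // t _ /=; rewrite -EFinM normal_pdfE ?oner_eq0//.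
rewrite mulrA mulVf ?gt_eqF ?normal_peak_gt0 ?oner_eq0// mul1r.
by rewrite /normal_fun subr0 expr1n mulNr.
Qed.

Lemma integrable_gauss_decayM f g : gauss_decay f -> gauss_decay g ->
  mu.-integrable setT (fun t => (f t * g t)%:E).
Proof.
move=> df dg; have [mfg [C C0 HC]] := gauss_decay_mul df dg.
have := integrableZl measurableT C integrable_expR_half.
apply: le_integrable => //; first exact/measurable_EFinP.
move=> t _ /=; rewrite lee_fin (le_trans (HC t))// ger0_norm// mulr_ge0// expR_ge0//.
Qed.

Lemma gauss_decay_cvg f : gauss_decay f ->
  (f n%:R @[n --> \oo] --> (0 : R)) /\ (f (- n%:R) @[n --> \oo] --> (0 : R)).
Proof.
move=> [_ [C C0 HC]].
(* A harmonic majorant is enough: exp(n^2/4) >= 1 + n^2/4 >= (n+1)/4. *)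
have E : (C * 4) * (n.+1%:R)^-1 @[n --> \oo] --> (0 : R).
  rewrite -[X in _ --> X](mulr0 (C * 4)); apply: cvgMr.
  exact: cvg_harmonic.
have B (n : nat) : C * expR (- (n%:R ^+ 2 / 4)) <= (C * 4) * (n.+1%:R)^-1.
  rewrite -mulrA ler_wpM2l// expRN -[leRHS]invrK invfM invrK.
  rewrite lef_pV2 ?posrE ?expR_gt0 ?mulr_gt0//.
  apply: le_trans (expR_ge1Dx _).
  have := sqr_ge0 (n%:R - 2^-1 : R); rewrite -natr1; nra.
have S (h : R -> R) : (forall n : nat, `|h n%:R| <= C * expR (- (n%:R ^+ 2 / 4))) ->
    h n%:R @[n --> \oo] --> (0 : R).
  move=> Hh; apply/norm_cvg0P; apply: (squeeze_cvgr _ (cvg_cst 0) E).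
  by apply: nearW => n; rewrite normr_ge0 (le_trans (Hh n)).

split; first exact: S.
by apply: (S (fun t => f (- t))) => n; rewrite (le_trans (HC _))// sqrrN.
Qed.

(** The integrals over [-n, n] tend to the full one by dominated convergence, and by the fundamental
    theorem they are boundary terms, killed by the decay of F. This stands in for integration by
    parts. *)
Lemma Rintegral_deriv_eq0 F f : continuous f ->
  (forall t, is_derive t 1 F (f t)) -> gauss_decay F ->
  mu.-integrable setT (EFin \o f) -> (\int[mu]_t f t = 0)%R.
Proof.
move=> cf dF gF fi.
pose I (n : nat) : set R := `[- n%:R, n%:R]%classic.
have mI n : measurable (I n) by exact: measurable_itv.
have mf : measurable_fun setT f by exact: continuous_measurable_fun.
have mfI n : measurable_fun setT ((EFin \o f) \_ (I n)).
  apply/(measurable_restrictT (EFin \o f) (mI n)).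
  by apply: measurable_funTS; exact/measurable_EFinP.
have H1 := @dominated_cvg _ _ _ mu setT measurableT
  (fun n => (EFin \o f) \_ (I n)) (EFin \o f) (fun t => `|f t|%:E).
have {H1} : (\int[mu]_t ((EFin \o f) \_ (I n)) t @[n --> \oo]
    --> \int[mu]_t (f t)%:E)%E.
  apply: (H1 mfI).
  - move=> t _; apply: cvg_near_cst; near=> n.
    rewrite patchE ifT// inE /I /= in_itv /= -ler_norml.
    near: n; exact: nbhs_infty_ger.
  - by [].
  - exact: integrable_norm.
  - move=> n t _; rewrite patchE; case: ifP => //=.
    by rewrite normr0 lee_fin.
under eq_fun do rewrite -integral_mkcond.
move=> H1.
have H2 : (\int[mu]_(t in I n) (f t)%:E @[n --> \oo] --> (0%R%:E : \bar R))%E.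
  have [c1 c2] := gauss_decay_cvg gF.
  have c3 : ((F n%:R - F (- n%:R))%:E @[n --> \oo] --> (0%R%:E : \bar R))%E.
    apply: cvg_EFin; first exact: nearW.
    have := cvgB c1 c2; rewrite subr0; exact.
  apply: cvg_trans c3; apply: near_eq_cvg; near=> n.
  rewrite /I (@continuous_FTC2 _ f F)//.
  - rewrite gtrN// ltr0n; near: n; exact: nbhs_infty_gt.
  - exact: continuous_subspaceT.
  - split.
    + by move=> t _; have [] := dF t.
    + apply: cvg_at_right_filter; apply: differentiable_continuous.
      by apply/derivable1_diffP; have [] := dF (- n%:R).
    + apply: cvg_at_left_filter; apply: differentiable_continuous.
      by apply/derivable1_diffP; have [] := dF n%:R.
  - by move=> t _; rewrite derive1E; have [_ ] := dF t.
have := cvg_unique _ H1 H2; rewrite /Rintegral => -> //.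
Unshelve. all: by end_near. Qed.

End gaussian_decay.

(** * The Hermite equation, orthonormality and Parseval *)

Section hermite_orthonormal.
Context {R : realType}.
Implicit Types (a b m n k : nat) (t : R) (f g F : R -> R).
Local Notation mu := (@lebesgue_measure R).

Lemma gauss_decayM f g : gauss_decay f -> gauss_decay g ->
  gauss_decay (fun t => f t * g t).
Proof.
move=> df dg; have [m [C C0 HC]] := gauss_decay_mul df dg.
split => //; exists C => // t; apply: le_trans (HC t) _.
rewrite ler_wpM2l// ler_expR lerN2; have := sqr_ge0 t; nra.
Qed.

Definition dhermite a t : R := Num.sqrt (a%:R / 2) * hermite_fun a.-1 t -
   Num.sqrt (a.+1%:R / 2) * hermite_fun a.+1 t.

Lemma dhermiteEl a t : dhermite a t =
  2 * Num.sqrt (a%:R / 2) * hermite_fun a.-1 t - t * hermite_fun a t.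
Proof. by rewrite /dhermite mulx_hermite_fun; ring. Qed.

Lemma dhermiteEr a t : dhermite a t =
  t * hermite_fun a t - 2 * Num.sqrt (a.+1%:R / 2) * hermite_fun a.+1 t.
Proof. by rewrite /dhermite mulx_hermite_fun; ring. Qed.

(** The Hermite equation. The form of h_a' containing only h_(a+1) is differentiated, and the form
    containing only the lower neighbour is then applied to h_(a+1), so the indices close up on
    h_a. *)
Global Instance is_derive_dhermite a t :
  is_derive t 1 (dhermite a) ((t ^+ 2 - (2 * a%:R + 1)) * hermite_fun a t).
Proof.
have -> : dhermite a = (id * hermite_fun a) -
    (2 * Num.sqrt (a.+1%:R / 2)) \*: hermite_fun a.+1.
  by apply/funext => s; rewrite dhermiteEr /GRing.scale /=.
apply: is_derive_eq; rewrite /GRing.scale /=.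
rewrite -/(dhermite a t) -/(dhermite a.+1 t) (dhermiteEl a.+1) (dhermiteEr a) [a.+1.-1]/=.
have E : a.+1%:R = 2 * Num.sqrt (a.+1%:R / 2) ^+ 2 :> R.
  by rewrite sqr_sqrtr ?divr_ge0//; field.
have -> : a%:R = 2 * Num.sqrt (a.+1%:R / 2) ^+ 2 - 1 :> R.
  by rewrite -E -natr1 addrK.
by ring.
Qed.

Lemma gauss_decay_dhermite a : gauss_decay (dhermite a).
Proof.
rewrite /dhermite; under eq_fun do rewrite -mulNr.
by apply: gauss_decayD; apply: gauss_decayZ; exact: gauss_decay_hermite.
Qed.

Lemma continuous_hermiteM a b :
  continuous (fun t : R => hermite_fun a t * hermite_fun b t).
Proof. by move=> t; apply: cvgM; exact: continuous_hermite_fun. Qed.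

Lemma integrable_hermiteM a b :
  mu.-integrable setT (fun t => (hermite_fun a t * hermite_fun b t)%:E).
Proof. by apply: integrable_gauss_decayM; exact: gauss_decay_hermite. Qed.

Lemma hermite_orthogonal a b : a != b ->
  (\int[mu]_t (hermite_fun a t * hermite_fun b t) = 0)%R.
Proof.
move=> ab.
(* F is the Wronskian of h_a and h_b; by the Hermite equation its derivative is h_a h_b times the
   difference c of the eigenvalues. *)
pose F t := dhermite a t * hermite_fun b t + (-1) * (hermite_fun a t * dhermite b t).
pose c : R := 2 * b%:R - 2 * a%:R.
have := @Rintegral_deriv_eq0 R F (fun t => c * (hermite_fun a t * hermite_fun b t)).
have dF t : is_derive t 1 F (c * (hermite_fun a t * hermite_fun b t)).
  have -> : F = dhermite a * hermite_fun b - hermite_fun a * dhermite b.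
    by apply/funext => s; rewrite /F mulN1r.
  apply: is_derive_eq; rewrite /GRing.scale /= /c.
  by rewrite -/(dhermite a t) -/(dhermite b t); ring.
have gF : gauss_decay F.
  by apply: gauss_decayD; [|apply: gauss_decayZ]; apply: gauss_decayM;
    (exact: gauss_decay_dhermite || exact: gauss_decay_hermite).
have cc : continuous (fun t => c * (hermite_fun a t * hermite_fun b t)).
  by move=> t; apply: cvgM; [exact: cvg_cst|exact: continuous_hermiteM].
have ic : mu.-integrable setT (EFin \o (fun t => c * (hermite_fun a t * hermite_fun b t))).
  have := integrableZl measurableT c (integrable_hermiteM a b).
  by apply: eq_integrable.
move=> /(_ cc dF gF ic); rewrite RintegralZl//; last exact: integrable_hermiteM.
move/eqP; rewrite mulf_eq0 => /orP[|/eqP//].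
rewrite /c subr_eq0 => /eqP /(mulfI _) /eqP; rewrite pnatr_eq0 => /(_ isT).
by rewrite eqr_nat eq_sym (negbTE ab).
Qed.

(** The derivative of h_a h_(a+1) has integral 0. Its two mixed terms vanish by orthogonality, and
    the other two carry the same coefficient, so h_(a+1) has the norm of h_a. The base case is the
    Gaussian integral. *)
Lemma hermite_norm a : (\int[mu]_t (hermite_fun a t * hermite_fun a t) = 1)%R.
Proof.
elim: a => [|a IH].
  rewrite /Rintegral.
  under eq_integral.
    move=> t _.
    rewrite (_ : _ * _ = (Num.sqrt pi)^-1 * gauss_fun t); last first.
      rewrite !hermite_funE hornerC mulr1 mulrACA -expRD /hermite_coef.
      rewrite expr0 mul1r fact0 mul1r -expr2 exprVn sqr_sqrtr ?sqrtr_ge0//.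
      by rewrite /gauss_fun; congr (_ * expR _); field.
    over.
  under eq_integral do rewrite EFinM.
  rewrite integralZl ?integralT_gauss//=; last exact: integrableT_gauss.
  by rewrite mulVf// gt_eqF// sqrtr_gt0 pi_gt0.
pose h := @hermite_fun R.
pose al b : R := Num.sqrt (b%:R / 2).
pose F t := h a t * h a.+1 t.
pose f t := al a * (h a.-1 t * h a.+1 t) + (- al a.+1) * (h a.+1 t * h a.+1 t) +
  (al a.+1 * (h a t * h a t) + (- al a.+2) * (h a t * h a.+2 t)).
have dF t : is_derive t 1 F (f t).
  have -> : F = h a * h a.+1 by [].
  apply: is_derive_eq; rewrite /GRing.scale /= /f /al /h; ring.
have gh := @gauss_decay_hermite R.
have gF : gauss_decay F by apply: gauss_decayM.
have cf : continuous f.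
  have cz (c : R) i j : continuous (fun t => c * (h i t * h j t)).
    by move=> t; apply: cvgM; [exact: cvg_cst|exact: continuous_hermiteM].
  by move=> t; apply: cvgD; apply: cvgD; exact: cz.
have iz (c : R) i j : mu.-integrable setT (EFin \o (fun t => c * (h i t * h j t))).
  by have := integrableZl measurableT c (integrable_hermiteM i j); apply: eq_integrable.
have id2 (f1 f2 : R -> R) : mu.-integrable setT (EFin \o f1) ->
    mu.-integrable setT (EFin \o f2) ->
    mu.-integrable setT (EFin \o (fun t => f1 t + f2 t)).
  by move=> i1 i2; have := integrableD measurableT i1 i2; apply: eq_integrable.
have fi : mu.-integrable setT (EFin \o f) by apply: (id2); apply: (id2); exact: iz.
have := Rintegral_deriv_eq0 cf dF gF fi.
rewrite /f !RintegralD//; try (by apply: (id2); exact: iz); try exact: iz.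
rewrite !RintegralZl//; try exact: integrable_hermiteM.
rewrite IH (@hermite_orthogonal a.-1 a.+1); last by case: (a) => //= n; rewrite ltn_eqF.
rewrite (@hermite_orthogonal a a.+2); last by rewrite ltn_eqF.
rewrite !mulr0 add0r addr0 mulr1 mulNr addrC => /eqP; rewrite subr_eq0 => /eqP.
rewrite -{1}[al a.+1]mulr1 => /mulfI ->//.
by rewrite gt_eqF// sqrtr_gt0 divr_gt0.
Qed.

Lemma hermite_orthonormal a b :
  (\int[mu]_t (hermite_fun a t * hermite_fun b t) = (a == b)%:R)%R.
Proof. by have [->|/hermite_orthogonal] := eqVneq a b; first exact: hermite_norm. Qed.

Lemma hermite_parseval n (c : nat -> R) :
  (\int[mu]_t ((\sum_(j < n) c j * hermite_fun j t) ^+ 2)%:E =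
   (\sum_(j < n) c j ^+ 2)%:E)%E.
Proof.
under eq_integral.
  move=> t _.
  rewrite (_ : _ ^+ 2 = \sum_(j < n) \sum_(i < n) c j * c i *
    (hermite_fun j t * hermite_fun i t)); last first.
    rewrite expr2 mulr_suml; apply: eq_bigr => j _; rewrite mulr_sumr.
    by apply: eq_bigr => i _; ring.
  rewrite -sumEFin; under eq_bigr do rewrite -sumEFin.
  over.
have iz (z : R) i j : mu.-integrable setT (fun t =>
   (z * (hermite_fun i t * hermite_fun j t))%:E).
  by have := integrableZl measurableT z (integrable_hermiteM i j); apply: eq_integrable.
rewrite integral_sum//; last first.
  by move=> j; apply: integrable_sum => // i _; exact: iz.
rewrite -sumEFin; apply: eq_bigr => j _.
rewrite integral_sum//.
under eq_bigr => i _.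
  under eq_integral do rewrite EFinM.
  rewrite integralZl//; last exact: integrable_hermiteM.
  rewrite -[X in (_ * X)%E]fineK; last first.
    by apply: integrable_fin_num => //; exact: integrable_hermiteM.
  rewrite -/(Rintegral _ _ _) hermite_orthonormal -EFinM.
  over.
rewrite /= sumEFin (bigD1 j)//= eqxx mulr1 big1 ?addr0// => i ij.
by rewrite (_ : (_ == _) = false) ?mulr0//; apply/negbTE; rewrite eq_sym.
Qed.

End hermite_orthonormal.

(** * Values near the origin *)

Section convolution.
Context {R : realType}.
Implicit Types (u v w : nat -> R) (k : nat).

(** The Cauchy product, i.e. the coefficients of a product of generating series. Projection kernels
    in several variables are Cauchy products of the one-dimensional h_a(x) h_a(y). *)
Definition convol u v k : R := \sum_(a < k.+1) u a * v (k - a)%N.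

Lemma convolC u v k : convol u v k = convol v u k.
Proof.
rewrite /convol (reindex_inj rev_ord_inj) /=; apply: eq_bigr => i _.
have ik : (i <= k)%N by rewrite -ltnS.
by rewrite subSS (subKn ik) mulrC.
Qed.

Lemma convolDl u v w k : convol (fun a => u a + v a) w k = convol u w k + convol v w k.
Proof. by rewrite /convol -big_split; apply: eq_bigr => i _; rewrite mulrDl. Qed.

Lemma convolDr u v w k : convol u (fun a => v a + w a) k = convol u v k + convol u w k.
Proof. by rewrite convolC convolDl !(convolC _ u). Qed.

(** Multiplication of the generating series by its variable. *)
Definition delay u a : R := if a is a'.+1 then u a' else 0.

Lemma convol_delayl u v k : convol (delay u) v k = delay (convol u v) k.
Proof.
case: k => [|k]; first by rewrite /convol big_ord1 /= mul0r.
by rewrite /convol big_ord_recl /= mul0r add0r; apply: eq_bigr => i _.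
Qed.

Lemma convol_delayr u v k : convol u (delay v) k = delay (convol u v) k.
Proof. by rewrite convolC convol_delayl; case: k => //= k; rewrite convolC. Qed.

End convolution.

Section hermite_near0.
Context {R : realType}.
Implicit Types (a b k : nat) (t : R).

Definition hermite0sq a : R := hermite_fun a 0 ^+ 2.
Local Notation q := hermite0sq.

Lemma hermite1_0 : hermite_fun 1 0 = 0 :> R.
Proof.
have := @mulx_hermite_fun R 0 0; rewrite !mul0r sqrtr0 mul0r add0r => /esym/eqP.
by rewrite mulf_eq0 gt_eqF ?sqrtr_gt0 ?divr_gt0//= => /eqP.
Qed.

Lemma hermite0sq_rec a : a.+2%:R * q a.+2 = a.+1%:R * q a.
Proof.
have := @mulx_hermite_fun R a.+1 0; rewrite mul0r [a.+1.-1]/= => /esym/eqP.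
rewrite /hermite0sq; move: (hermite_fun a.+2 0) (hermite_fun a 0) => u v.
rewrite addr_eq0 => /eqP /(congr1 (fun x => 2 * x ^+ 2)).
by rewrite sqrrN !exprMn !sqr_sqrtr ?divr_ge0//; lra.
Qed.

Lemma hermite0sq_ge0 a : 0 <= q a. Proof. exact: sqr_ge0. Qed.

(** The generating series of q is (pi (1 - x^2))^(-1/2), whose square has 2-periodic coefficients.
    In terms of sums: by the symmetry a <-> j - a, the sum S weighted by the first index is j/2
    times the convolution, and the recurrence of q turns S at k+2 into S at k plus one
    convolution. *)
Lemma convol_hermite0sq_rec k : convol q q k.+2 = convol q q k.
Proof.
pose S j := \sum_(a < j.+1) a%:R * (q a * q (j - a)%N).
have S2 j : 2 * S j = j%:R * convol q q j.
  have -> : 2 * S j = S j + S j by ring.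
  rewrite {1}/S (reindex_inj rev_ord_inj) /= /S -big_split /convol mulr_sumr.
  apply: eq_bigr => i _ /=.
  have ij : (i <= j)%N by rewrite -ltnS.
  by rewrite subSS subKn// natrB//; ring.
have SS : S k.+2 = S k + convol q q k.
  rewrite {1}/S big_ord_recl big_ord_recl mul0r add0r /=.
  rewrite /bump /= [q 1]/hermite0sq hermite1_0 expr0n/= mul0r mulr0 add0r.
  rewrite /S /convol -big_split; apply: eq_bigr => i _ /=.
  rewrite /bump /= !add1n !subSS mulrA hermite0sq_rec -natr1; ring.
have := S2 k.+2; rewrite SS mulrDr S2 -[k.+2%:R]natr1 -[k.+1%:R]natr1 => /eqP.
rewrite (_ : _ + _ = (k%:R + 1 + 1) * convol q q k); last by ring.
by move/eqP/mulfI => -> //; rewrite !natr1.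
Qed.

Lemma convol_hermite0sq_le k : convol q q k <= q 0 ^+ 2.
Proof.
elim/ltn_ind: k => -[|[|k]] IH.
- by rewrite /convol big_ord1 subnn expr2.
- rewrite /convol big_ord_recl big_ord1 /= [q _.+1]/hermite0sq.
  by rewrite /hermite0sq hermite1_0 expr0n /= mulr0 mul0r addr0 sqr_ge0.
- by rewrite convol_hermite0sq_rec IH.
Qed.

(* Sonin's function, monotone in |t|. *)
Lemma hermite_sonin a t :
  (2 * a%:R + 1 - t ^+ 2) * hermite_fun a t ^+ 2 <=
  dhermite a 0 ^+ 2 + (2 * a%:R + 1) * q a.
Proof.
pose F (s : R) := dhermite a s ^+ 2 + (2 * a%:R + 1 - s ^+ 2) * hermite_fun a s ^+ 2.
suff : F t <= F 0.
  rewrite /F expr0n subr0 => H; apply: le_trans H.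
  by rewrite lerDr sqr_ge0.
have dF (s : R) : is_derive s 1 F (- (2 * s) * hermite_fun a s ^+ 2).
  have -> : F = (dhermite a) ^+ 2 +
      (cst (2 * a%:R + 1) - id ^+ 2) * (hermite_fun a) ^+ 2 by [].
  apply: is_derive_eq; rewrite /GRing.scale /= -/(dhermite a s).
  rewrite (_ : (cst (2 * a%:R + 1) - id ^+ 2 : R -> R) s =
    2 * a%:R + 1 - s ^+ 2) //.
  rewrite (_ : (hermite_fun a ^+ 2 : R -> R) s = hermite_fun a s ^+ 2) //.
  by ring.
(* Moving along the segment from 0 to t treats both signs of t at once: the derivative becomes -2 s
   (t h)^2. *)
pose G (s : R) := F (s * t).
have dG (s : R) : is_derive s 1 G (- (2 * (s * t)) * hermite_fun a (s * t) ^+ 2 * t).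
  have H : is_derive s 1 (fun s => s * t) t.
    have -> : (fun s => s * t) = t \*: id.
      by apply/funext => x; rewrite /= /GRing.scale /= mulrC.
    by apply: is_derive_eq; rewrite /GRing.scale /= mulr1.
  exact: (@is_derive1_comp _ F (fun s => s * t)).
have -> : F t = G 1 by rewrite /G mul1r.
have -> : F 0 = G 0 by rewrite /G mul0r.
apply: (@ler0_derive1_nincr _ G 0 1) => //.
- move=> s; rewrite in_itv /= => /andP[s0 s1]; rewrite derive1E.
  have -> := @derive_val _ _ _ _ _ _ _ (dG s).
  move: (hermite_fun a (s * t)) => h.
  rewrite (_ : - (2 * (s * t)) * h ^+ 2 * t = - (2 * s * (t * h) ^+ 2)).
    by rewrite oppr_le0 mulr_ge0 ?sqr_ge0// mulr_ge0// ltW.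
  by ring.
- apply: continuous_subspaceT => s; apply: differentiable_continuous.
  by apply/derivable1_diffP; have [] := dG s.
Qed.

(** For odd a the value q_a is 0, so it cannot control h_a nearby; the slope at the origin, whose
    square is 2 a q_(a-1), takes over. Hence the delayed term. *)
Lemma hermite_near0_le a t : `|t| <= 1 ->
  hermite_fun a t ^+ 2 <= 3 / 2 * (q a + delay q a).
Proof.
move=> t1; case: a => [|a].
  rewrite /= addr0 /hermite0sq !hermite_funE !hornerC !mulr1 expr0n mul0r oppr0.
  rewrite expR0 mulr1 exprMn mulrC; have c0 := sqr_ge0 (hermite_coef 0 : R).
  apply: ler_wpM2r => //.
  apply: (@le_trans _ _ 1); last by lra.
  rewrite expr_le1// ?expR_ge0// -expR0 ler_expR oppr_le0 divr_ge0// sqr_ge0//.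
have := hermite_sonin a.+1 t.
have t2 : t ^+ 2 <= 1 by rewrite -real_normK ?num_real// expr_le1.
have H := sqr_ge0 (hermite_fun a.+1 t).
rewrite dhermiteEl mul0r subr0 [a.+1.-1]/= [delay _ _]/=.
have -> : (2 * Num.sqrt (a.+1%:R / 2) * hermite_fun a 0) ^+ 2 = 2 * a.+1%:R * q a.
  rewrite /hermite0sq; move: (hermite_fun a 0) => h.
  by rewrite !exprMn sqr_sqrtr ?divr_ge0//; field.
have qa := hermite0sq_ge0 a; have qSa := hermite0sq_ge0 a.+1.
have n1 : 1 <= a.+1%:R :> R by rewrite ler1n.
move: (a.+1%:R) n1 => N n1 HS.
(* With |t| <= 1, Sonin's inequality gives 2 N h^2 <= 2 N q_a + (2 N + 1) q_(a+1); since N >= 1,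
   division by 2 N leaves factors at most 3/2. *)
rewrite -(@ler_pM2l _ (2 * N)); last by lra.
apply: (@le_trans _ _ ((2 * N + 1 - t ^+ 2) * hermite_fun a.+1 t ^+ 2)).
  by rewrite ler_wpM2r//; lra.
apply: le_trans HS _.
have : 0 <= (N - 1) * q a.+1 by apply: mulr_ge0 => //; lra.
have : 0 <= N * q a by apply: mulr_ge0 => //; lra.
by nra.
Qed.

(** The 9 is (3/2)^2 times the four convolutions of q and its delay, each of which is at most
    q_0^2. *)
Lemma convol_hermite_near0_le k s t : `|s| <= 1 -> `|t| <= 1 ->
  convol (fun a => hermite_fun a s ^+ 2) (fun a => hermite_fun a t ^+ 2) k <=
  9 * q 0 ^+ 2.
Proof.
move=> s1 t1.
apply: (@le_trans _ _ (convol (fun a => 3 / 2 * (q a + delay q a))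
   (fun a => 3 / 2 * (q a + delay q a)) k)).
  apply: ler_sum => i _; apply: ler_pM; try exact: sqr_ge0;
    exact: hermite_near0_le.
have -> : convol (fun a => 3 / 2 * (q a + delay q a))
   (fun a => 3 / 2 * (q a + delay q a)) k =
   9 / 4 * convol (fun a => q a + delay q a) (fun a => q a + delay q a) k.
  by rewrite /convol mulr_sumr; apply: eq_bigr => i _; field.
rewrite (convolDl q (delay q)) !(convolDr _ q (delay q)).
have -> : convol (delay q) (delay q) k = delay (delay (convol q q)) k.
  rewrite convol_delayl; congr (delay _ k).
  by apply/funext => j; rewrite convol_delayr.
rewrite convol_delayl convol_delayr.
have P := convol_hermite0sq_le; have q0 := sqr_ge0 (q 0).
case: k => [|[|k]] /=.
- by have := P 0; lra.
- by have := P 0; have := P 1; lra.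
- have := P k; have := P k.+1; have := P k.+2; lra.
Qed.

End hermite_near0.

(** * Combinations of Hermite functions on R^n *)

Section multiindices.

(** Multiindices of length k as lists, so that an induction on the dimension can split off the first
    entry; the remaining entries then have the smaller sum k - j. *)
Fixpoint comps (n k : nat) : seq (seq nat) :=
  if n is m.+1 then
    [seq j :: s | j <- index_iota 0 k.+1, s <- comps m (k - j)]
  else if k is 0 then [:: [::]] else [::].

Lemma big_compsS (V : nmodType) (n k : nat) (F : seq nat -> V) :
  \sum_(s <- comps n.+1 k) F s =
  \sum_(j < k.+1) \sum_(s <- comps n (k - j)) F (nat_of_ord j :: s).
Proof.
transitivity (\sum_(s <- [seq j :: s | j <- index_iota 0 k.+1,
  s <- comps n (k - j)]) F s) => //.
by rewrite big_allpairs_dep big_mkord.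
Qed.

Lemma mem_comps n k s :
  (s \in comps n k) = (size s == n) && (sumn s == k).
Proof.
elim: n k s => [|n IH] k s; first by case: k s => [|k] [].
apply/allpairsPdep/andP => [[j [t]]|].
  rewrite mem_index_iota IH /= => -[jk /andP[/eqP <- /eqP tk] ->] /=.
  by rewrite tk subnKC.
case: s => [[]//|j s] [/= sn /eqP sk]; exists j, s; split=> //.
  by rewrite mem_index_iota /= -sk ltnS leq_addr.
by rewrite IH -(eqSS (size s)) sn -sk addKn eqxx.
Qed.

Lemma uniq_comps n k : uniq (comps n k).
Proof.
elim: n k => [|n IH] k; first by case: k.
apply: allpairs_uniq_dep; first exact: iota_uniq.
  by move=> j _; exact: IH.
by move=> [i s] [j t] _ _ /= [-> ->].
Qed.

End multiindices.

Section tonelli.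
Context {R : realType}.
Local Notation mu := (@lebesgue_measure R).

Lemma tnth_cons_pair0 n (z : R) (y : euclidean R n) :
  tnth (cons_pair (z, y)) ord0 = z.
Proof. by rewrite (tnth_nth z). Qed.

Lemma tnth_cons_pairS n (z : R) (y : euclidean R n) (i : 'I_n) :
  tnth (cons_pair (z, y)) (lift ord0 i) = tnth y i.
Proof. by rewrite !(tnth_nth z). Qed.

Lemma integral_lebesgue_cons n (f : euclidean R n.+1 -> \bar R) :
  measurable_fun setT f -> (forall x, 0 <= f x)%E ->
  (\int[lebesgueN R n.+1]_x f x =
   \int[mu \x lebesgueN R n]_p f (cons_pair p))%E.
Proof.
move=> mf f0.
rewrite -[RHS](@ge0_integral_pushforward _ _ _ _ _ _ (@measurable_cons_pair R n)
  (mu \x lebesgueN R n)%E setT f)//.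
Qed.

Lemma measurable_comp_cons n (f : euclidean R n.+1 -> \bar R) :
  measurable_fun setT f -> measurable_fun setT (f \o @cons_pair R n).
Proof. by move=> mf; apply: measurableT_comp => //; exact: measurable_cons_pair. Qed.

(** The new coordinate is the inner integral, so that one-dimensional orthonormality or a
    one-dimensional dilation applies with y fixed. *)
Lemma integral_lebesgueNS n (f : euclidean R n.+1 -> \bar R) :
  measurable_fun setT f -> (forall x, 0 <= f x)%E ->
  (\int[lebesgueN R n.+1]_x f x =
   \int[lebesgueN R n]_y \int[mu]_z f (cons_pair (z, y)))%E.
Proof.
move=> mf f0; rewrite integral_lebesgue_cons//.
exact: (fubini_tonelli2 _ (measurable_comp_cons mf)
  (fun p => f0 (cons_pair p))).
Qed.

Lemma integral_lebesgueN0 (f : euclidean R 0 -> \bar R) :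
  measurable_fun setT f ->
  (\int[lebesgueN R 0]_x f x = f [tuple])%E.
Proof. by move=> mf; rewrite /= integral_dirac// diracT mul1e. Qed.

End tonelli.

Section hermite_combinations.
Context {R : realType}.
Local Notation mu := (@lebesgue_measure R).
Implicit Types (n k : nat) (s : seq nat) (c : seq nat -> R).

Definition hermite_seq n s (x : euclidean R n) : R :=
  \prod_(i < n) hermite_fun (nth 0 s i) (tnth x i).

(** The general element of the range of P_k. The coefficient function is total, and dropping a
    variable amounts to fixing the first entry of its argument. *)
Definition hermite_comb n k c (x : euclidean R n) : R :=
  \sum_(s <- comps n k) c s * hermite_seq s x.

Lemma hermite_seq_cons n j s (z : R) (y : euclidean R n) :
  hermite_seq (j :: s) (cons_pair (z, y)) = hermite_fun j z * hermite_seq s y.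
Proof.
rewrite /hermite_seq big_ord_recl tnth_cons_pair0; congr (_ * _).
by apply: eq_bigr => i _; rewrite tnth_cons_pairS.
Qed.

Lemma hermite_comb_cons n k c (z : R) (y : euclidean R n) :
  hermite_comb k c (cons_pair (z, y)) =
  \sum_(j < k.+1) hermite_comb (k - j) (fun s => c (nat_of_ord j :: s)) y *
                  hermite_fun j z.
Proof.
rewrite /hermite_comb big_compsS; apply: eq_bigr => j _.
by rewrite mulr_suml; apply: eq_bigr => s _; rewrite hermite_seq_cons; ring.
Qed.

Lemma measurable_hermite_fun m : measurable_fun setT (@hermite_fun R m).
Proof. by have [] := @gauss_decay_hermite R m. Qed.

Lemma measurable_hermite_seq n s :
  measurable_fun setT (@hermite_seq n s).
Proof.
rewrite /hermite_seq; apply: measurable_prod => i _.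
apply: measurableT_comp; first exact: measurable_hermite_fun.
exact: measurable_tnth.
Qed.

Lemma measurable_hermite_comb n k c :
  measurable_fun setT (@hermite_comb n k c).
Proof.
rewrite /hermite_comb; apply: measurable_sum => s.
by apply: measurable_funM => //; exact: measurable_hermite_seq.
Qed.

Lemma measurable_hermite_comb_w n k c (w : euclidean R n -> R) :
  measurable_fun setT w ->
  measurable_fun setT (fun x => ((hermite_comb k c x) ^+ 2 * w x)%:E).
Proof.
move=> mw; apply/measurable_EFinP; apply: measurable_funM => //.
by apply: measurable_funX; exact: measurable_hermite_comb.
Qed.

(* The extra variable is integrated first: its Hermite functions are orthonormal,
   so a weight not depending on it only sees the diagonal terms. *)
Lemma hermite_comb_lift n k c (w : euclidean R n -> R) :
  measurable_fun setT w -> (forall x, 0 <= w x) ->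
  (\int[lebesgueN R n]_y \int[mu]_z
     ((hermite_comb k c (cons_pair (z, y))) ^+ 2 * w y)%:E =
   \sum_(j < k.+1) \int[lebesgueN R n]_y
     ((hermite_comb (k - j) (fun s => c (nat_of_ord j :: s)) y) ^+ 2 * w y)%:E)%E.
Proof.
move=> mw w0.
rewrite -ge0_integral_sum//; last 2 first.
- by move=> j; exact: measurable_hermite_comb_w.
- by move=> j y _; rewrite lee_fin mulr_ge0 ?sqr_ge0.
apply: eq_integral => y _; rewrite sumEFin -mulr_suml EFinM.
rewrite -(hermite_parseval k.+1
  (fun j => hermite_comb (k - j) (fun s => c (j :: s)) y)) muleC -ge0_integralZl//; last 3 first.
- apply/measurable_EFinP; apply: measurable_funX; apply: measurable_sum => j.
  by apply: measurable_funM => //; exact: measurable_hermite_fun.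
- by move=> z _; rewrite lee_fin sqr_ge0.
- by rewrite lee_fin.
by apply: eq_integral => z _; rewrite hermite_comb_cons -EFinM mulrC.
Qed.

(** The weighted estimate on the range of P_k, with one constant for all k; by orthonormality the
    square sum is the squared norm of the combination. *)
Definition hermite_bound n (w : euclidean R n -> R) (C : R) := forall k c,
  (\int[lebesgueN R n]_x ((hermite_comb k c x) ^+ 2 * w x)%:E <=
   (C * \sum_(s <- comps n k) c s ^+ 2)%:E)%E.

(** The comparison is asked for almost every y only: at y = 0 the inverse of 0 is 0, and there the
    weight 1/|y|^2 would not dominate. *)
Lemma hermite_bound_cons n (w : euclidean R n -> R) (v : euclidean R n.+1 -> R) C :
  measurable_fun setT w -> (forall x, 0 <= w x) ->
  measurable_fun setT v -> (forall x, 0 <= v x) ->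
  {ae lebesgueN R n, forall y, forall z, v (cons_pair (z, y)) <= w y} ->
  hermite_bound w C -> hermite_bound v C.
Proof.
move=> mw w0 mv v0 vw Hw k c.
have mF : measurable_fun setT (fun p : measurableTypeR R * euclidean R n =>
    ((hermite_comb k c (cons_pair p)) ^+ 2 * v (cons_pair p))%:E).
  exact: (measurable_comp_cons (measurable_hermite_comb_w k c mv)).
have mG : measurable_fun setT (fun p : measurableTypeR R * euclidean R n =>
    ((hermite_comb k c (cons_pair p)) ^+ 2 * w p.2)%:E).
  apply/measurable_EFinP; apply: measurable_funM => //; last first.
    by apply: measurableT_comp.
  apply: measurable_funX; apply: measurableT_comp.
    exact: measurable_hermite_comb.
  exact: measurable_cons_pair.
rewrite integral_lebesgueNS//; last 2 first.
- exact: measurable_hermite_comb_w.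
- by move=> x; rewrite lee_fin mulr_ge0// sqr_ge0.
apply: (@le_trans _ _ (\int[lebesgueN R n]_y \int[mu]_z
     ((hermite_comb k c (cons_pair (z, y))) ^+ 2 * w y)%:E)%E).
  apply: ae_ge0_le_integral => //.
  - by move=> y _; apply: integral_ge0 => z _; rewrite lee_fin mulr_ge0// sqr_ge0.
  - apply: (@measurable_fun_fubini_tonelli_G _ _ _ _ _ mu _ mF).
    by move=> p; rewrite lee_fin mulr_ge0// sqr_ge0.
  - by move=> y _; apply: integral_ge0 => z _; rewrite lee_fin mulr_ge0// sqr_ge0.
  - apply: (@measurable_fun_fubini_tonelli_G _ _ _ _ _ mu _ mG).
    by move=> p; rewrite lee_fin mulr_ge0// sqr_ge0.
  apply: (filterS _ vw) => y vwy _; apply: ge0_le_integral => //.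
  - by move=> z _; rewrite lee_fin mulr_ge0// sqr_ge0.
  - exact: (measurableT_comp mF (measurable_pair2 y)).
  - exact: (measurableT_comp mG (measurable_pair2 y)).
  - by move=> z _; rewrite lee_fin ler_wpM2l ?sqr_ge0.
rewrite hermite_comb_lift// big_compsS mulr_sumr -sumEFin.
by apply: lee_sum => j _; exact: Hw.
Qed.

(** Variables are added one at a time, starting from the one-point space. This weight covers the
    region where the singular one is at most 1. *)
Lemma hermite_bound1 n : hermite_bound (fun _ : euclidean R n => 1) 1.
Proof.
elim: n => [|n IH]; last first.
  by apply: hermite_bound_cons IH => //; apply: aeW.
move=> k c; rewrite integral_lebesgueN0; last first.
  exact: measurable_hermite_comb_w.
rewrite lee_fin mulr1 mul1r /hermite_comb /=.
case: k => [|k] /=; last by rewrite !big_nil expr0n.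
by rewrite !big_seq1 /hermite_seq big_ord0 mulr1.
Qed.

Lemma hermite_boundD n (w w1 w2 : euclidean R n -> R) C1 C2 :
  measurable_fun setT w -> (forall x, 0 <= w x) ->
  measurable_fun setT w1 -> (forall x, 0 <= w1 x) ->
  measurable_fun setT w2 -> (forall x, 0 <= w2 x) ->
  (forall x, w x <= w1 x + w2 x) ->
  hermite_bound w1 C1 -> hermite_bound w2 C2 -> hermite_bound w (C1 + C2).
Proof.
move=> mw w0 mw1 w10 mw2 w20 ww H1 H2 k c.
rewrite mulrDl EFinD; apply: le_trans (leeD (H1 k c) (H2 k c)).
rewrite -ge0_integralD//.
- apply: ge0_le_integral => //.
  + by move=> x _; rewrite lee_fin mulr_ge0// sqr_ge0.
  + exact: measurable_hermite_comb_w.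
  + by apply: emeasurable_funD; exact: measurable_hermite_comb_w.
  + by move=> x _; rewrite -EFinD lee_fin -mulrDr ler_wpM2l// sqr_ge0.
- by move=> x _; rewrite lee_fin mulr_ge0// sqr_ge0.
- exact: measurable_hermite_comb_w.
- by move=> x _; rewrite lee_fin mulr_ge0// sqr_ge0.
- exact: measurable_hermite_comb_w.
Qed.

End hermite_combinations.

(** * Rotation invariance *)

Section convol_assoc.
Context {R : realType}.
Implicit Types (u v w : nat -> R) (k : nat).

Lemma convol_coef u v N k : (k < N)%N ->
  convol u v k = (\poly_(i < N) u i * \poly_(i < N) v i)`_k.
Proof.
move=> kN; rewrite coefM /convol; apply: eq_bigr => i _.
by rewrite !coef_poly !ifT// (leq_ltn_trans _ kN)// ?leq_subr// -ltnS.
Qed.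

Lemma eq_convol u v u' v' k : (forall i, (i <= k)%N -> u i = u' i) ->
  (forall i, (i <= k)%N -> v i = v' i) -> convol u v k = convol u' v' k.
Proof.
move=> uu vv; apply: eq_bigr => i _.
by rewrite uu ?vv// ?leq_subr// -ltnS.
Qed.

(** Associativity is inherited from polynomials: truncating the sequences beyond k does not affect
    the coefficients up to k. *)
Lemma convolA u v w k : convol u (convol v w) k = convol (convol u v) w k.
Proof.
pose P f := \poly_(i < k.+1) (f i : R).
have PP f g : forall i, (i <= k)%N -> convol f g i = (P f * P g)`_i.
  by move=> i ik; exact: convol_coef.
have E f g : convol f g k = (P f * P g)`_k by exact: PP.
have PM f g h : (P (convol f g) * P h)`_k = (P f * P g * P h)`_k.
  rewrite !coefM; apply: eq_bigr => i _; congr (_ * _).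
  by rewrite coef_poly ltn_ord PP// -ltnS.
rewrite (E u) (E (convol u v)) PM [P u * _]mulrC PM.
by have -> : P v * P w * P u = P u * P v * P w by ring.
Qed.

End convol_assoc.

Section rotation.
Context {R : realType}.
Implicit Types (a b k : nat) (t s x y z : R).
Local Notation h := (@hermite_fun R).

Lemma polar x y : exists z, x = Num.sqrt (x ^+ 2 + y ^+ 2) * cos z /\
  y = Num.sqrt (x ^+ 2 + y ^+ 2) * sin z.
Proof.
set r := Num.sqrt _.
have r2 : r ^+ 2 = x ^+ 2 + y ^+ 2 by rewrite sqr_sqrtr// addr_ge0// sqr_ge0.
have [r0|r0] := eqVneq r 0.
  exists 0; move: r2; rewrite r0 !mul0r expr0n /= => /esym/eqP.
  by rewrite paddr_eq0 ?sqr_ge0// !sqrf_eq0 => /andP[/eqP -> /eqP ->].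
have rp : 0 < r by rewrite lt_def r0 sqrtr_ge0.
have xr : -1 <= x / r <= 1.
  rewrite -ler_norml normrM normfV (gtr0_norm rp) ler_pdivrMr// mul1r.
  rewrite -(@ler_pXn2r _ 2) ?nnegrE ?(ltW rp)// real_normK ?num_real// r2.
  by rewrite lerDl sqr_ge0.
have cx : cos (acos (x / r)) = x / r by rewrite acosK// in_itv.
have := sin2cos2 (acos (x / r)); rewrite cx => sE.
have : sin (acos (x / r)) ^+ 2 = (y / r) ^+ 2.
  have r20 : r ^+ 2 != 0 by rewrite sqrf_eq0.
  rewrite sE !expr_div_n; apply: (mulIf r20).
  by rewrite mulrBl !divfK// r2; ring.
(* The angle acos(x/r) has the right cosine but its sine is right only up to sign; the opposite
   angle repairs this. *)
move/eqP; rewrite eqf_sqr => /orP[|] /eqP sx.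
  by exists (acos (x / r)); rewrite cx sx !(mulrC r) !divfK.
by exists (- acos (x / r)); rewrite cosN sinN cx sx opprK !(mulrC r) !divfK.
Qed.

Definition hermite_kernel2 k x1 x2 y1 y2 : R :=
  convol (fun a => h a x1 * h a y1) (fun b => h b x2 * h b y2) k.

Let al a : R := Num.sqrt (a%:R / 2).
Let pr a b x1 x2 := h a x1 * h b x2.

(* Along a rotation, [a + b = k] fixed, the derivative of [h_a h_b] only
   involves its two neighbours [h_(a+1) h_(b-1)] and [h_(a-1) h_(b+1)]. *)
Let is_derive_pr a b t z : is_derive z 1
  (fun z => pr a b (t * cos z) (t * sin z))
  (2 * al a.+1 * al b * pr a.+1 b.-1 (t * cos z) (t * sin z) -
   2 * al a * al b.+1 * pr a.-1 b.+1 (t * cos z) (t * sin z)).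
Proof.
have dc : is_derive z 1 (fun z => t * cos z) (- (t * sin z)).
  have -> : (fun z => t * cos z) = t \*: (@cos R) by [].
  by apply: is_derive_eq; rewrite /GRing.scale /= mulrN.
have ds : is_derive z 1 (fun z => t * sin z) (t * cos z).
  have -> : (fun z => t * sin z) = t \*: (@sin R) by [].
  exact: is_derive_eq.
have d1 := @is_derive1_comp _ (h a) (fun z => t * cos z) z _ _
  (is_derive_hermite_fun a _) dc.
have d2 := @is_derive1_comp _ (h b) (fun z => t * sin z) z _ _
  (is_derive_hermite_fun b _) ds.
have -> : (fun z => pr a b (t * cos z) (t * sin z)) =
  (h a \o (fun z => t * cos z)) * (h b \o (fun z => t * sin z)) by [].
apply: is_derive_eq; rewrite /GRing.scale /=.
rewrite -/(al a) -/(al b) -/(al a.+1) -/(al b.+1) /pr.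
have := mulx_hermite_fun a (t * cos z); have := mulx_hermite_fun b (t * sin z).
rewrite -/(al a) -/(al b) -/(al a.+1) -/(al b.+1).
set X := t * cos z; set Y := t * sin z => EY EX.
transitivity ((X * h a X) * (al b * h b.-1 Y - al b.+1 * h b.+1 Y) -
  (Y * h b Y) * (al a * h a.-1 X - al a.+1 * h a.+1 X)); first by ring.
by rewrite EX EY; ring.
Qed.

(** The derivative in the angle telescopes over a + b = k; the end terms vanish because the ladder
    coefficient of index 0 does. *)
Lemma hermite_kernel2_rot k t s z :
  hermite_kernel2 k (t * cos z) (t * sin z) (s * cos z) (s * sin z) =
  hermite_kernel2 k t 0 s 0.
Proof.
pose G z := hermite_kernel2 k (t * cos z) (t * sin z) (s * cos z) (s * sin z).
have -> : hermite_kernel2 k t 0 s 0 = G 0.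
  by rewrite /G cos0 sin0 !mulr1 !mulr0.
apply: (@is_derive_0_is_cst _ G) => {}z.
(* [E a] is the exchange between the indices (a, k-a) and (a+1, k-a-1): it enters the derivative of
   term a with a plus sign and that of term a+1 with a minus sign. *)
pose E a := 2 * al a.+1 * al (k - a)%N *
  (pr a.+1 (k - a).-1 (t * cos z) (t * sin z) *
   pr a (k - a)%N (s * cos z) (s * sin z) +
   pr a (k - a)%N (t * cos z) (t * sin z) *
   pr a.+1 (k - a).-1 (s * cos z) (s * sin z)).
have -> : G = \sum_(a < k.+1)
   ((fun z => pr a (k - a)%N (t * cos z) (t * sin z)) *
    (fun z => pr a (k - a)%N (s * cos z) (s * sin z))).
  apply/funext => x; rewrite /G /hermite_kernel2 /convol fct_sumE.
  by apply: eq_bigr => i _; rewrite mulrACA.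
pose D (a : nat) : R := E a - delay E a.
have -> : 0 = \sum_(a < k.+1) D a.
  have ET j : \sum_(a < j.+1) D a = E j.
    elim: j => [|j IH]; first by rewrite big_ord1 /D /= subr0.
    by rewrite big_ord_recr IH /D /= addrC subrK.
  by rewrite ET /E subnn /al mul0r sqrtr0 mulr0 mul0r.
apply: is_derive_sum => a.
have d1 := is_derive_pr a (k - a)%N t z; have d2 := is_derive_pr a (k - a)%N s z.
apply: (@is_derive_eq _ _ _ _ _ _ _ _ (is_deriveM d1 d2)).
rewrite /GRing.scale /= /D.
case: a {d1 d2} => -[|a] /= ak.
  rewrite /E subr0 subn0 /al mul0r sqrtr0; ring.
have -> : E a = 2 * al a.+1 * al (k - a.+1).+1 *
  (pr a.+1 (k - a.+1) (t * cos z) (t * sin z) *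
   pr a (k - a.+1).+1 (s * cos z) (s * sin z) +
   pr a (k - a.+1).+1 (t * cos z) (t * sin z) *
   pr a.+1 (k - a.+1) (s * cos z) (s * sin z)).
  rewrite /E -subnS (_ : (k - a)%N = (k - a.+1).+1)//.
  by rewrite subnSK// -ltnS.
rewrite /E; ring.
Qed.

Lemma hermite_kernel2_polar k t s x y :
  hermite_kernel2 k (t * x) (t * y) (s * x) (s * y) =
  hermite_kernel2 k (t * Num.sqrt (x ^+ 2 + y ^+ 2)) 0
                    (s * Num.sqrt (x ^+ 2 + y ^+ 2)) 0.
Proof.
have [z []] := polar x y; move: (Num.sqrt _) => r -> ->; rewrite !mulrA.
exact: hermite_kernel2_rot.
Qed.

Definition hermite_kernel3 k t s x y z : R :=
  convol (fun a => h a (t * x) * h a (s * x))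
       (convol (fun a => h a (t * y) * h a (s * y))
             (fun a => h a (t * z) * h a (s * z))) k.

(** Two planar rotations suffice: (y, z) is moved to (r', 0), then (x, r') to (r, 0), with
    associativity regrouping the factors in between. Both points lie on one line, so the same
    rotations serve both. *)
Lemma hermite_kernel3_polar k t s x y z :
  let r := Num.sqrt (x ^+ 2 + (y ^+ 2 + z ^+ 2)) in
  hermite_kernel3 k t s x y z =
  convol (fun a => h a (r * t) * h a (r * s)) (convol hermite0sq hermite0sq) k.
Proof.
move=> r; rewrite /hermite_kernel3.
set r' := Num.sqrt (y ^+ 2 + z ^+ 2).
have r'2 : r' ^+ 2 = y ^+ 2 + z ^+ 2 by rewrite sqr_sqrtr// addr_ge0// sqr_ge0.
have E : r = Num.sqrt (x ^+ 2 + r' ^+ 2) by rewrite r'2.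
transitivity (convol (fun a => h a (t * x) * h a (s * x))
       (convol (fun a => h a (t * r') * h a (s * r')) hermite0sq) k).
  by apply: eq_convol => // i _; exact: (hermite_kernel2_polar i t s y z).
rewrite convolA.
transitivity (convol (convol (fun a => h a (t * r) * h a (s * r)) hermite0sq)
   hermite0sq k).
  by apply: eq_convol => // i _; rewrite E; exact: (hermite_kernel2_polar i t s x r').
by rewrite -convolA; apply: eq_convol => // i _; rewrite !(mulrC r).
Qed.

End rotation.

(** * Restriction to lines and averaging *)

Section dilation.
Context {R : realType}.
Local Notation mu := (@lebesgue_measure R).

Definition dilation (r : R) (x : measurableTypeR R) : measurableTypeR R := r * x.

Lemma measurable_dilation (r : R) : measurable_fun setT (dilation r).
Proof. exact: (measurable_funM (measurable_cst r) (@measurable_id _ _ setT)). Qed.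

Lemma lebesgue_measure_dilation (r : R) (A : set R) : 0 < r -> measurable A ->
  (r%:E * pushforward mu (dilation r) A = mu A)%E.
Proof.
move=> r0 mA.
pose m : {measure set (measurableTypeR R) -> \bar R} :=
  measure_function_pushforward__canonical__measure_function_Measure
    mu (measurable_dilation r).
apply/esym; apply: (lebesgue_measure_unique (mu := mscale (NngNum (ltW r0)) m)) => //.
move=> _ [[a b]] _ <-.
transitivity (r%:E * mu (dilation r @^-1` `]a, b]))%E => //.
have -> : dilation r @^-1` `]a, b] = `]r^-1 * a, r^-1 * b]%classic.
  apply/seteqP; split=> x /=; rewrite /dilation !in_itv /= ltr_pdivrMl// ler_pdivlMl//.
rewrite !lebesgue_measure_itv/= !lte_fin ltr_pM2l ?invr_gt0//.
case: ifP => _; last by rewrite mule0.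
by rewrite -!EFinD -EFinM -mulrBr mulrA divff ?mul1r// gt_eqF.
Qed.

Lemma ge0_integral_dilation (r : R) (f : R -> \bar R) : 0 < r ->
  measurable_fun setT f -> (forall x, 0 <= f x)%E ->
  (\int[mu]_x f (r * x)%R = r^-1%:E * \int[mu]_x f x)%E.
Proof.
move=> r0 mf f0.
pose m : {measure set (measurableTypeR R) -> \bar R} :=
  measure_function_pushforward__canonical__measure_function_Measure
    mu (measurable_dilation r).
have E : (\int[mu]_x f x = r%:E * \int[m]_x f x)%E.
  rewrite -(@ge0_integral_mscale _ _ _ m setT measurableT (NngNum (ltW r0)))//.
  apply: eq_measure_integral => A mA _.
  exact/esym/lebesgue_measure_dilation.
rewrite E muleA -EFinM mulVf ?gt_eqF// mul1e.
by rewrite (ge0_integral_pushforward (measurable_dilation r)).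
Qed.

Definition dilate n (t : R) (x : euclidean R n) : euclidean R n :=
  [tuple t * tnth x i | i < n].

Lemma measurable_dilate n :
  measurable_fun setT (fun p : measurableTypeR R * euclidean R n => dilate p.1 p.2).
Proof.
apply/measurable_fun_tnthP => i /=.
rewrite (_ : _ \o _ = fun p : measurableTypeR R * euclidean R n => p.1 * tnth p.2 i);
  last by apply/funext => p /=; rewrite tnth_mktuple.
apply: measurable_funM => //.
by apply: (@measurableT_comp _ _ _ _ _ _ (fun x => tnth x i)) => //;
  exact: measurable_tnth.
Qed.

Lemma measurable_dilate1 n (t : R) : measurable_fun setT (@dilate n t).
Proof. exact: (measurableT_comp (@measurable_dilate n) (measurable_pair1 t)). Qed.

Lemma dilate_cons n (t z : R) (y : euclidean R n) :
  dilate t (cons_pair (z, y)) = cons_pair (t * z, dilate t y).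
Proof.
apply: eq_from_tnth => i; rewrite tnth_mktuple.
case: (unliftP ord0 i) => [j ->|->]; last by rewrite !tnth_cons_pair0.
by rewrite !tnth_cons_pairS tnth_mktuple.
Qed.

Lemma integral_dilate n (t : R) (f : euclidean R n -> \bar R) : 0 < t ->
  measurable_fun setT f -> (forall x, 0 <= f x)%E ->
  (\int[lebesgueN R n]_x f (dilate t x) =
   (t^-1 ^+ n)%:E * \int[lebesgueN R n]_x f x)%E.
Proof.
move=> t0; elim: n f => [|n IH] f mf f0.
  have mft : measurable_fun setT (fun x => f (dilate t x)).
    by apply: measurableT_comp => //; exact: measurable_dilate1.
  rewrite !integral_lebesgueN0// expr0 mul1e; congr f.
  by apply: eq_from_tnth => -[].
have mft : measurable_fun setT (fun x => f (dilate t x)).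
  by apply: measurableT_comp => //; exact: measurable_dilate1.
rewrite !integral_lebesgueNS//.
transitivity (\int[lebesgueN R n]_y ((t^-1)%:E * \int[mu]_z f (cons_pair (z, dilate t y))))%E.
  apply: eq_integral => y _.
  under eq_integral do rewrite dilate_cons.
  rewrite (ge0_integral_dilation (f := fun z => f (cons_pair (z, dilate t y))))//.
  exact: (measurableT_comp (measurable_comp_cons mf) (measurable_pair2 (dilate t y))).
have mF : measurable_fun setT (fun y => (\int[mu]_z f (cons_pair (z, y)))%E).
  by apply: (@measurable_fun_fubini_tonelli_G _ _ _ _ _ mu _ (measurable_comp_cons mf)) => p;
    exact: f0.
rewrite ge0_integralZl//.
- rewrite (IH (fun y => (\int[mu]_z f (cons_pair (z, y)))%E))//.
    by rewrite muleA -EFinM -exprS.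
  by move=> y; apply: integral_ge0.
- by apply: (measurableT_comp mF); exact: measurable_dilate1.
- by move=> y _; apply: integral_ge0.
- by rewrite lee_fin invr_ge0 ltW.
Qed.

End dilation.

(** * Inner products on the line and Bessel's inequality *)

Section gauss_inner_product.
Context {R : realType}.
Local Notation mu := (@lebesgue_measure R).
Implicit Types (f g : R -> R).

Definition gauss_ip f g : R := (\int[mu]_t (f t * g t))%R.

Lemma gauss_ipC f g : gauss_ip f g = gauss_ip g f.
Proof. by apply: eq_Rintegral => t _; rewrite mulrC. Qed.

Lemma gauss_ip_ge0 f : 0 <= gauss_ip f f.
Proof. by apply: Rintegral_ge0 => t _; rewrite -expr2 sqr_ge0. Qed.

Lemma gauss_ipDl f1 f2 g : gauss_decay f1 -> gauss_decay f2 -> gauss_decay g ->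
  gauss_ip (fun t => f1 t + f2 t) g = gauss_ip f1 g + gauss_ip f2 g.
Proof.
move=> d1 d2 dg; rewrite /gauss_ip -RintegralD//.
- by apply: eq_Rintegral => t _; rewrite mulrDl.
- exact: integrable_gauss_decayM.
- exact: integrable_gauss_decayM.
Qed.

Lemma gauss_ipZl (c : R) f g : gauss_decay f -> gauss_decay g ->
  gauss_ip (fun t => c * f t) g = c * gauss_ip f g.
Proof.
move=> df dg; rewrite /gauss_ip -RintegralZl//.
  by apply: eq_Rintegral => t _; rewrite mulrA.
exact: integrable_gauss_decayM.
Qed.

Lemma gauss_ip_suml (I : Type) (r : seq I) (c : I -> R) (F : I -> R -> R) g :
  (forall i, gauss_decay (F i)) -> gauss_decay g ->
  gauss_ip (fun t => \sum_(i <- r) c i * F i t) g =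
  \sum_(i <- r) c i * gauss_ip (F i) g.
Proof.
move=> dF dg; elim: r => [|i r IH].
  rewrite big_nil /gauss_ip; transitivity (\int[mu]_t (0 : R))%R.
    by apply: eq_Rintegral => t _; rewrite big_nil mul0r.
  by rewrite Rintegral_cst// mul0r.
rewrite big_cons -IH -gauss_ipZl// -gauss_ipDl//.
- by congr gauss_ip; apply/funext => t; rewrite big_cons.
- exact: gauss_decayZ.
- by apply: gauss_decay_sum => j; exact: gauss_decayZ.
Qed.

Lemma gauss_ipE f : gauss_decay f ->
  (\int[mu]_t (f t ^+ 2)%:E = (gauss_ip f f)%:E)%E.
Proof.
move=> df; rewrite /gauss_ip /Rintegral fineK.
  by apply: eq_integral => t _; rewrite expr2.
by apply: integrable_fin_num => //; exact: integrable_gauss_decayM.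
Qed.

Lemma gauss_ip_sqrB f g (c : R) : gauss_decay f -> gauss_decay g ->
  0 <= gauss_ip f f - 2 * c * gauss_ip f g + c ^+ 2 * gauss_ip g g.
Proof.
move=> df dg.
have dg' := gauss_decayZ (- c) dg; have dd := gauss_decayD df dg'.
have := gauss_ip_ge0 (fun t => f t + (- c) * g t).
rewrite gauss_ipDl// gauss_ipZl// [gauss_ip f _]gauss_ipC [gauss_ip g _]gauss_ipC.
rewrite !gauss_ipDl// !gauss_ipZl// [gauss_ip g f]gauss_ipC.
by move=> H; apply: le_trans H _; rewrite le_eqVlt; apply/orP; left; apply/eqP; ring.
Qed.

(** The decay rate is fixed at 1/4, and r >= 1 preserves it; lines are accordingly parametrized by
    vectors of norm at least 1. *)
Lemma gauss_decay_dilation (r : R) f : 1 <= r -> gauss_decay f ->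
  gauss_decay (fun t => f (r * t)).
Proof.
move=> r1 [mf [C C0 HC]]; split.
  exact: (measurableT_comp mf (measurable_dilation r)).
exists C => // t; rewrite (le_trans (HC _))// ler_wpM2l// ler_expR lerN2.
rewrite exprMn ler_wpM2r// ler_peMl ?sqr_ge0//.
by rewrite expr2; nra.
Qed.

(** The orthonormal family is sqrt r h_a(r t), so Bessel's inequality carries a factor 1/r on the
    right, which r >= 1 absorbs. *)
Lemma hermite_bessel_dilation n (r : R) f : 1 <= r -> gauss_decay f ->
  \sum_(a < n) gauss_ip f (fun t => hermite_fun a (r * t)) ^+ 2 <= gauss_ip f f.
Proof.
move=> r1 df.
pose d a := gauss_ip f (fun t => hermite_fun a (r * t)).
pose g t := \sum_(a < n) d a * hermite_fun a (r * t).
have dh a : gauss_decay (fun t => hermite_fun a (r * t)).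
  by apply: gauss_decay_dilation => //; exact: gauss_decay_hermite.
have dg : gauss_decay g.
  by apply: gauss_decay_sum => a; exact: gauss_decayZ.
have fg : gauss_ip f g = \sum_(a < n) d a ^+ 2.
  rewrite gauss_ipC gauss_ip_suml//; apply: eq_bigr => a _.
  by rewrite gauss_ipC expr2.
have r0 : 0 < r by rewrite (lt_le_trans ltr01).
have gg : gauss_ip g g = r^-1 * \sum_(a < n) d a ^+ 2.
  apply: EFin_inj; rewrite -gauss_ipE// EFinM -hermite_parseval.
  rewrite -(ge0_integral_dilation (f := fun t =>
    ((\sum_(a < n) d a * hermite_fun a t) ^+ 2)%:E))//.
  - apply/measurable_EFinP; apply: measurable_funX; apply: measurable_sum => a.
    by apply: measurable_funM => //; exact: measurable_hermite_fun.
  - by move=> t; rewrite lee_fin sqr_ge0.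
(* The coefficient r is the optimal one: r g is the orthogonal projection of f onto the dilated
   Hermite functions. *)
have := gauss_ip_sqrB r df dg; rewrite fg gg -/(d _).
have S0 : 0 <= \sum_(a < n) d a ^+ 2 by apply: sumr_ge0 => a _; exact: sqr_ge0.
rewrite -/(\sum_(a < n) d a ^+ 2); move: (\sum_(a < n) _) S0 => S S0.
have -> : r ^+ 2 * (r^-1 * S) = r * S by rewrite expr2 -mulrA mulVKf// gt_eqF.
by nra.
Qed.

End gauss_inner_product.

Section line_bound.
Context {R : realType}.
Local Notation mu := (@lebesgue_measure R).

Lemma big_comps1 (V : nmodType) k (F : seq nat -> V) :
  \sum_(s <- comps 1 k) F s = F [:: k].
Proof.
rewrite big_compsS big_ord_recr /= subnn big_seq1 big1 ?add0r// => i _.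
have : (0 < k - i)%N by rewrite subn_gt0.
by case: (k - i)%N => // m _; rewrite big_nil.
Qed.

Lemma big_comps2 (V : nmodType) k (F : seq nat -> V) :
  \sum_(s <- comps 2 k) F s = \sum_(i < k.+1) F [:: nat_of_ord i; (k - i)%N].
Proof. by rewrite big_compsS; apply: eq_bigr => i _; rewrite big_comps1. Qed.

Lemma big_comps3 (V : nmodType) k (F : seq nat -> V) :
  \sum_(s <- comps 3 k) F s =
  \sum_(a < k.+1) \sum_(b < (k - a).+1) F [:: nat_of_ord a; nat_of_ord b; (k - a - b)%N].
Proof.
rewrite big_compsS; apply: eq_bigr => a _.
by rewrite big_compsS; apply: eq_bigr => b _; rewrite big_comps1.
Qed.

Definition sqnorm n (x : euclidean R n) : R := \sum_(i < n) tnth x i ^+ 2.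

Lemma gauss_decay_hermite_line n s (w : euclidean R n) : 1 <= sqnorm w ->
  gauss_decay (fun t => hermite_seq s (dilate t w)).
Proof.
move=> w1; split.
  rewrite /hermite_seq; apply: measurable_prod => i _.
  under eq_fun do rewrite tnth_mktuple.
  apply: (measurableT_comp (measurable_hermite_fun _)).
  exact: (measurable_funM (@measurable_id _ _ setT) (measurable_cst _)).
have [C C0 HC] : exists2 C : R, 0 <= C & forall t : R,
    `|hermite_seq s (dilate t w)| <= C * expR (- (t ^+ 2 * sqnorm w / 4)).
  rewrite /hermite_seq /sqnorm.
  elim: (index_enum _) => [|i r [C C0 IH]].
    by exists 1 => // t; rewrite !big_nil mulr0 mul0r oppr0 expR0 mulr1 normr1.
  have [D D0 HD] := @hermite_fun_decay R (nth 0 s i).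
  exists (D * C) => [|t]; first exact: mulr_ge0.
  rewrite !big_cons normrM.
  have -> : - (t ^+ 2 * (tnth w i ^+ 2 + \sum_(j <- r) tnth w j ^+ 2) / 4) =
    - ((t * tnth w i) ^+ 2 / 4) + - (t ^+ 2 * (\sum_(j <- r) tnth w j ^+ 2) / 4).
    by field.
  rewrite expRD mulrACA ler_pM//.
  by rewrite tnth_mktuple; exact: HD.
exists C => // t; rewrite (le_trans (HC t))// ler_wpM2l// ler_expR lerN2.
by rewrite ler_wpM2r// ler_peMr// sqr_ge0.
Qed.

Lemma hermite_seq_kernel3 k (t u : R) (w : euclidean R 3) :
  \sum_(s <- comps 3 k) hermite_seq s (dilate t w) * hermite_seq s (dilate u w) =
  convol (fun a => hermite_fun a (Num.sqrt (sqnorm w) * t) *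
                   hermite_fun a (Num.sqrt (sqnorm w) * u))
    (convol hermite0sq hermite0sq) k.
Proof.
have -> : sqnorm w = tnth w ord0 ^+ 2 + (tnth w (lift ord0 ord0) ^+ 2 +
    tnth w (lift ord0 (lift ord0 ord0)) ^+ 2).
  by rewrite /sqnorm !big_ord_recl big_ord0 addr0.
rewrite -hermite_kernel3_polar big_comps3 /hermite_kernel3 /convol.
apply: eq_bigr => a _; rewrite mulr_sumr; apply: eq_bigr => b _.
rewrite /hermite_seq !big_ord_recl !big_ord0 !tnth_mktuple /=.
by ring.
Qed.

(** Let T send coefficients to functions on the line, so that f = T c and b is the adjoint of T
    applied to f. The operator T composed with its adjoint is diagonal in the dilated Hermite
    functions, with entries at most P, so Bessel gives |b|^2 <= P |f|^2, while |f|^2 is the pairing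
    of c with b. *)
Lemma hermite_line_bound k c (w : euclidean R 3) : 1 <= sqnorm w ->
  (\int[mu]_t ((hermite_comb k c (dilate t w)) ^+ 2)%:E <=
   (hermite0sq 0 ^+ 2 * \sum_(s <- comps 3 k) c s ^+ 2)%:E)%E.
Proof.
move=> w1; set P := hermite0sq 0 ^+ 2.
have dH s := gauss_decay_hermite_line s w1.
pose f t := hermite_comb k c (dilate t w).
have df : gauss_decay f.
  by apply: gauss_decay_sum => s; apply: gauss_decayZ; exact: dH.
rewrite gauss_ipE// lee_fin.
pose r := Num.sqrt (sqnorm w).
have r1 : 1 <= r by rewrite -sqrtr1 ler_wsqrtr.
pose b s := gauss_ip f (fun t => hermite_seq s (dilate t w)).
pose d a := gauss_ip f (fun t => hermite_fun a (r * t)).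
have dh a : gauss_decay (fun t => hermite_fun a (r * t)).
  by apply: gauss_decay_dilation => //; exact: gauss_decay_hermite.
have fE : gauss_ip f f = \sum_(s <- comps 3 k) c s * b s.
  rewrite {1}/f /hermite_comb gauss_ip_suml//; apply: eq_bigr => s _.
  by rewrite gauss_ipC.
have bE : \sum_(s <- comps 3 k) b s ^+ 2 =
    \sum_(a < k.+1) convol hermite0sq hermite0sq (k - a) * d a ^+ 2.
  have b1 : \sum_(s <- comps 3 k) b s ^+ 2 = gauss_ip
      (fun t => \sum_(s <- comps 3 k) b s * hermite_seq s (dilate t w)) f.
    rewrite gauss_ip_suml//; apply: eq_bigr => s _.
    by rewrite gauss_ipC expr2.
  (* T b is written as an integral operator applied to f; rotation invariance diagonalizes its
     kernel. *)
  have b2 t : \sum_(s <- comps 3 k) b s * hermite_seq s (dilate t w) =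
      \sum_(a < k.+1) (convol hermite0sq hermite0sq (k - a) * d a) *
        hermite_fun a (r * t).
    transitivity (gauss_ip (fun u => \sum_(s <- comps 3 k)
        hermite_seq s (dilate t w) * hermite_seq s (dilate u w)) f).
      rewrite gauss_ip_suml//; apply: eq_bigr => s _.
      by rewrite mulrC /b gauss_ipC.
    transitivity (gauss_ip (fun u => \sum_(a < k.+1)
       (convol hermite0sq hermite0sq (k - a) * hermite_fun a (r * t)) *
        hermite_fun a (r * u)) f).
      congr gauss_ip; apply/funext => u; rewrite hermite_seq_kernel3.
      by apply: eq_bigr => a _; rewrite -/r; ring.
    rewrite gauss_ip_suml//; apply: eq_bigr => a _.
    by rewrite gauss_ipC -/(d a); ring.
  rewrite b1; under [in LHS]eq_fun do rewrite b2.
  rewrite gauss_ip_suml//; apply: eq_bigr => a _.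
  by rewrite gauss_ipC -/(d a); ring.
have bP : \sum_(s <- comps 3 k) b s ^+ 2 <= P * gauss_ip f f.
  rewrite bE; apply: (@le_trans _ _ (P * \sum_(a < k.+1) d a ^+ 2)).
    rewrite mulr_sumr; apply: ler_sum => a _.
    by rewrite ler_wpM2r ?sqr_ge0// convol_hermite0sq_le.
  by rewrite ler_wpM2l ?sqr_ge0//; exact: hermite_bessel_dilation.
have P0 : 0 < P.
  rewrite /P /hermite0sq hermite_funE hornerC !exprn_gt0// !mulr_gt0// ?expR_gt0//.
  exact: hermite_coef_gt0.
(* With S = |c|^2 and N = |f|^2 the square expands to P^2 S - 2 P N + |b|^2, and |b|^2 <= P N leaves
   N <= P S. *)
have : 0 <= \sum_(s <- comps 3 k) (P * c s - b s) ^+ 2.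
  by apply: sumr_ge0 => s _; exact: sqr_ge0.
have -> : \sum_(s <- comps 3 k) (P * c s - b s) ^+ 2 =
   P ^+ 2 * (\sum_(s <- comps 3 k) c s ^+ 2) - 2 * P * gauss_ip f f +
   \sum_(s <- comps 3 k) b s ^+ 2.
  rewrite fE !mulr_sumr -sumrB -big_split; apply: eq_bigr => s _ /=; ring.
move: bP; move: (\sum_(s <- comps 3 k) b s ^+ 2) => B.
move: (\sum_(s <- comps 3 k) c s ^+ 2) (gauss_ip f f) => S N BP H.
rewrite -(ler_pM2l P0).
have -> : P * (P * S) = P ^+ 2 * S by ring.
lra.
Qed.

End line_bound.

(** * Averaging over directions and the weight |x|^(-2) *)

Section averaging.
Context {R : realType}.
Local Notation mu := (@lebesgue_measure R).

Lemma sqnorm_ge0 n (x : euclidean R n) : 0 <= sqnorm x.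
Proof. by apply: sumr_ge0 => i _; exact: sqr_ge0. Qed.

Lemma measurable_sqnorm n : measurable_fun setT (@sqnorm R n).
Proof.
apply: measurable_sum => i; apply: measurable_funX; exact: measurable_tnth.
Qed.

Lemma sqnorm_dilate n (t : R) (x : euclidean R n) :
  sqnorm (dilate t x) = t ^+ 2 * sqnorm x.
Proof.
by rewrite /sqnorm mulr_sumr; apply: eq_bigr => i _; rewrite tnth_mktuple exprMn.
Qed.

Lemma measurable_funVge0 d (T : measurableType d) (f : T -> R) :
  (forall x, 0 <= f x) -> measurable_fun setT f ->
  measurable_fun setT (fun x => (f x)^-1).
Proof.
move=> f0 mf; under eq_fun do rewrite -powR_inv1//.
by apply: (@measurableT_comp _ _ _ _ _ _ (@powR R ^~ (-1))); first exact: measurable_powR.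
Qed.

Lemma lebesgueN_cube n (r : R) : 0 <= r ->
  lebesgueN R n [set x | forall i, `[- r, r]%classic (tnth x i)] =
  ((2 * r) ^+ n)%:E.
Proof.
move=> r0; rewrite (@lebesgueN_box R n (fun=> `[- r, r]%classic))//.
have E : lebesgue_measure (`[- r, r]%classic : set R) = (2 * r)%:E.
  rewrite lebesgue_measure_itv /= lte_fin.
  have [r1|r1] := ltP (- r) r; first by rewrite -EFinB; congr (_%:E); ring.
  by congr (_%:E); lra.
under eq_bigr do rewrite E.
by rewrite prodEFin prodr_const card_ord.
Qed.

Lemma measurable_cube n (r : R) :
  measurable [set x : euclidean R n | forall i, `[- r, r]%classic (tnth x i)].
Proof.
rewrite (_ : [set _ | _] = \bigcap_(i in [set: 'I_n])
    ((fun x : euclidean R n => tnth x i) @^-1` `[- r, r]%classic)).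
  apply: fin_bigcap_measurable => // i _.
  rewrite -[X in measurable X]setTI.
  exact: (@measurable_tnth _ (measurableTypeR R) n i measurableT).
by apply/seteqP; split=> x /= Hx i; [move=> _|]; exact: Hx.
Qed.

Definition in_shell n (t : R) (x : euclidean R n) : bool :=
  (t ^+ 2 <= sqnorm x) && (sqnorm x <= 4 * t ^+ 2).

Lemma measurable_in_shell n : measurable_fun setT
  (fun p : measurableTypeR R * euclidean R n => in_shell p.1 p.2).
Proof.
have m1 : measurable_fun setT
    (fun p : measurableTypeR R * euclidean R n => p.1 ^+ 2).
  by apply: measurable_funX.
have m2 : measurable_fun setT
    (fun p : measurableTypeR R * euclidean R n => sqnorm p.2).
  by apply: (measurableT_comp (@measurable_sqnorm n)).
apply: measurable_and; apply: measurable_fun_ler => //.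
exact: measurable_funM.
Qed.

Lemma measurable_in_shell1 n (t : R) : measurable_fun setT (@in_shell n t).
Proof.
apply: measurable_and; apply: measurable_fun_ler => //;
  exact: measurable_sqnorm.
Qed.

(** Since the inverse of 0 is 0, [Num.max t 0] makes the density vanish for t <= 0, so it can be
    integrated over the whole line. *)
Definition shell_density n (t : R) (x : euclidean R n) : R :=
  if in_shell t x then (Num.max t 0)^-1 ^+ 3 else 0.

Lemma shell_density_ge0 n t (x : euclidean R n) : 0 <= shell_density t x.
Proof.
by rewrite /shell_density; case: ifP => // _; rewrite exprn_ge0// invr_ge0 le_max lexx orbT.
Qed.

Lemma measurable_shell_density n : measurable_fun setT
  (fun p : measurableTypeR R * euclidean R n => shell_density p.1 p.2).
Proof.
apply: measurable_fun_ifT => //; first exact: measurable_in_shell.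
apply: measurable_funX; apply: measurable_funVge0.
  by move=> p; rewrite le_max lexx orbT.
exact: measurable_maxr.
Qed.

Lemma le_integral_shell_density n (x : euclidean R n) :
  (((sqnorm x)^-1)%:E <= 2%:E * \int[mu]_t (shell_density t x)%:E)%E.
Proof.
have [->|x0] := eqVneq (sqnorm x) 0.
  rewrite invr0 mule_ge0// integral_ge0// => t _; rewrite lee_fin.
  exact: shell_density_ge0.
pose r := Num.sqrt (sqnorm x).
have r2 : sqnorm x = r ^+ 2 by rewrite sqr_sqrtr// sqnorm_ge0.
have r0 : 0 < r by rewrite sqrtr_gt0 lt_def x0 sqnorm_ge0.
have md : measurable_fun setT (fun t : R => (shell_density t x)%:E).
  apply/measurable_EFinP.
  exact: (measurableT_comp (@measurable_shell_density n) (measurable_pair2 x)).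
(* For t in [r/2, r] the point x lies in the shell and t^(-3) >= r^(-3); the length r/2 of this
   interval explains the factor 2. *)
pose D : set R := `[r / 2, r]%classic.
have mD : measurable D by exact: measurable_itv.
apply: (@le_trans _ _ (2%:E * \int[mu]_(t in D) (r^-1 ^+ 3)%:E)%E).
  rewrite integral_cst//.
  rewrite /D [X in (_ * (_ * X))%E]lebesgue_measure_itv /= lte_fin ifT; last by lra.
  rewrite -EFinB -!EFinM lee_fin r2.
  rewrite le_eqVlt; apply/orP; left; apply/eqP; field; exact: lt0r_neq0.
rewrite lee_pmul2l//.
apply: (@le_trans _ _ (\int[mu]_(t in D) (shell_density t x)%:E)%E).
  apply: ge0_le_integral => //.
  - by move=> t _; rewrite lee_fin exprn_ge0// invr_ge0 ltW.
  - exact: measurable_funTS.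
  move=> t; rewrite /D /= in_itv /= => /andP[rt tr].
  have t0 : 0 < t by rewrite (lt_le_trans _ rt)// divr_gt0.
  rewrite lee_fin /shell_density /in_shell r2 ifT; last first.
    by apply/andP; split; nra.
  rewrite max_l ?(ltW t0)// lerXn2r ?nnegrE ?invr_ge0 ?(ltW t0) ?(ltW r0)//.
  by rewrite lef_pV2 ?posrE.
apply: ge0_subset_integral => //.
by move=> t _; rewrite lee_fin shell_density_ge0.
Qed.

(* Each shell average is rewritten with x = t w: the Jacobian t^3 cancels the
   weight of the shell density, and w stays in a fixed shell. *)
Lemma averaging_bound (F : euclidean R 3 -> R) (M : R) : 0 <= M ->
  measurable_fun setT F -> (forall x, 0 <= F x) ->
  (forall w, 1 <= sqnorm w -> (\int[mu]_t (F (dilate t w))%:E <= M%:E)%E) ->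
  (\int[lebesgueN R 3]_x (F x * (sqnorm x)^-1)%:E <= (128 * M)%:E)%E.
Proof.
move=> M0 mF F0 HM.
pose nu := lebesgueN R 3.
pose J (p : measurableTypeR R * euclidean R 3) := (F p.2 * shell_density p.1 p.2)%:E.
have mJ : measurable_fun setT J.
  apply/measurable_EFinP; apply: measurable_funM.
    by apply: (measurableT_comp mF).
  exact: measurable_shell_density.
have J0 p : (0 <= J p)%E by rewrite lee_fin mulr_ge0// shell_density_ge0.
pose K (p : measurableTypeR R * euclidean R 3) : \bar R :=
  if in_shell 1 p.2 then (F (dilate p.1 p.2))%:E else 0%E.
have mK : measurable_fun setT K.
  apply: measurable_fun_ifT => //.
    have m1 : measurable_fun setT (@in_shell 3 1).
      exact: measurable_in_shell1.
    exact: (measurableT_comp m1).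
  apply/measurable_EFinP; apply: (measurableT_comp mF).
  exact: measurable_dilate.
have K0 p : (0 <= K p)%E by rewrite /K; case: ifP => // _; rewrite lee_fin.
apply: (@le_trans _ _ (2%:E * \int[nu]_x \int[mu]_t J (t, x))%E).
  rewrite -ge0_integralZl//; last 2 first.
  - exact: (@measurable_fun_fubini_tonelli_G _ _ _ _ _ mu _ mJ J0).
  - by move=> x _; apply: integral_ge0.
  apply: ge0_le_integral => //.
  - by move=> x _; rewrite lee_fin mulr_ge0// invr_ge0 sqnorm_ge0.
  - apply/measurable_EFinP; apply: measurable_funM => //.
    apply: measurable_funVge0; first exact: sqnorm_ge0.
    exact: measurable_sqnorm.
  - apply: measurable_funeM.
    exact: (@measurable_fun_fubini_tonelli_G _ _ _ _ _ mu _ mJ J0).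
  move=> x _; rewrite /J /=; under eq_integral do rewrite EFinM.
  rewrite ge0_integralZl//; last 2 first.
  - by move=> t _; rewrite lee_fin shell_density_ge0.
  - by rewrite lee_fin.
    by rewrite EFinM muleCA lee_wpmul2l// ?lee_fin// le_integral_shell_density.
  apply/measurable_EFinP.
  exact: (measurableT_comp (@measurable_shell_density 3) (measurable_pair2 x)).
have swap (f : measurableTypeR R * euclidean R 3 -> \bar R) :
    measurable_fun setT f -> (forall p, 0 <= f p)%E ->
    (\int[mu]_t \int[nu]_x f (t, x) = \int[nu]_x \int[mu]_t f (t, x))%E.
  by move=> mf f0; exact: fubini_tonelli.
rewrite -(swap J)//.
apply: (@le_trans _ _ (2%:E * \int[mu]_t \int[nu]_w K (t, w))%E).
  rewrite lee_pmul2l//; apply: ge0_le_integral => //.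
  - by move=> t _; apply: integral_ge0.
  - exact: (@measurable_fun_fubini_tonelli_F _ _ _ _ _ nu _ mJ J0).
  - exact: (@measurable_fun_fubini_tonelli_F _ _ _ _ _ nu _ mK K0).
  move=> t _.
  (* The substitution x = t w requires t > 0; for the other t the density is 0. *)
  have [t0|t0] := leP t 0.
    rewrite integral0_eq; first by apply: integral_ge0.
    move=> x _; rewrite /J /shell_density /= max_r// invr0 expr0n /=.
    by case: ifP => _; rewrite mulr0.
  pose g (x : euclidean R 3) := if in_shell t x then (F x)%:E else 0%E.
  have mg : measurable_fun setT g.
    apply: measurable_fun_ifT => //; last exact/measurable_EFinP.
    exact: measurable_in_shell1.
  have g0 x : (0 <= g x)%E by rewrite /g; case: ifP => // _; rewrite lee_fin.
  have -> : (\int[nu]_x J (t, x) = (t^-1 ^+ 3)%:E * \int[nu]_x g x)%E.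
    rewrite -ge0_integralZl//; last by rewrite lee_fin exprn_ge0// invr_ge0 ltW.
    apply: eq_integral => x _; rewrite /J /g /shell_density /= max_l ?(ltW t0)//.
    by case: ifP => _; rewrite ?mulr0 ?mule0// -EFinM mulrC.
  rewrite -integral_dilate//; apply: ge0_le_integral => //.
  - by apply: (measurableT_comp mg); exact: measurable_dilate1.
  - exact: (measurableT_comp mK (measurable_pair1 t)).
  move=> w _; rewrite /g /K /in_shell /= sqnorm_dilate expr1n mulr1.
  rewrite -[X in (X <= t ^+ 2 * _)]mulr1 [4 * _]mulrC.
  by rewrite !(ler_pM2l (exprn_gt0 _ t0)).
rewrite (swap K)//.
have -> : 128 * M = 2 * (M * 64) by ring.
rewrite EFinM lee_pmul2l//.
(* The fixed shell 1 <= |w| <= 2 lies in the cube of side 4, of volume 64. *)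
pose B := [set x : euclidean R 3 | forall i, `[- 2, 2]%classic (tnth x i)].
have mB : measurable B by exact: measurable_cube.
apply: (@le_trans _ _ (\int[nu]_(w in B) M%:E)%E); last first.
  rewrite (integral_cst nu mB).
  rewrite [X in (_ * X <= _)%E](_ : _ = ((2 * 2) ^+ 3)%:E); last exact: lebesgueN_cube.
  rewrite -EFinM lee_fin ler_wpM2l//.
  by rewrite !exprS expr0; lra.
rewrite [leRHS]integral_mkcond; apply: ge0_le_integral => //.
- by move=> w _; apply: integral_ge0.
- exact: (@measurable_fun_fubini_tonelli_G _ _ _ _ _ mu _ mK K0).
- apply/(measurable_restrictT (fun=> M%:E) mB); exact: measurable_cst.
move=> w _; rewrite /K /=; have [/andP[w1 w4]|_] := boolP (in_shell 1 w).
  rewrite patchE ifT; first by apply: HM; move: w1; rewrite expr1n.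
  rewrite inE /B /= => i; rewrite in_itv /= -ler_norml.
  rewrite -(@ler_pXn2r _ 2) ?nnegrE// real_normK ?num_real//.
  have : tnth w i ^+ 2 <= sqnorm w.
    by rewrite /sqnorm (bigD1 i)//= lerDl; apply: sumr_ge0 => j _; exact: sqr_ge0.
  by move: w4; rewrite expr1n; lra.
rewrite integral0 patchE; case: ifP => //= _; by rewrite lee_fin.
Qed.

Definition inv_sqnorm n (x : euclidean R n) : R := (sqnorm x)^-1.

Lemma inv_sqnorm_ge0 n (x : euclidean R n) : 0 <= inv_sqnorm x.
Proof. by rewrite invr_ge0 sqnorm_ge0. Qed.

Lemma measurable_inv_sqnorm n : measurable_fun setT (@inv_sqnorm n).
Proof.
by apply: measurable_funVge0; [exact: sqnorm_ge0|exact: measurable_sqnorm].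
Qed.

Lemma hermite_bound_inv_sqnorm3 :
  hermite_bound (@inv_sqnorm 3) (128 * @hermite0sq R 0 ^+ 2).
Proof.
move=> k c; rewrite -mulrA; apply: averaging_bound.
- by rewrite mulr_ge0 ?sqr_ge0// sumr_ge0// => s _; exact: sqr_ge0.
- by apply: measurable_funX; exact: measurable_hermite_comb.
- by move=> x; exact: sqr_ge0.
- by move=> w w1; exact: hermite_line_bound.
Qed.

Lemma sqnorm_cons n (z : R) (y : euclidean R n) :
  sqnorm (cons_pair (z, y)) = z ^+ 2 + sqnorm y.
Proof.
rewrite /sqnorm big_ord_recl tnth_cons_pair0; congr (_ + _).
by apply: eq_bigr => i _; rewrite tnth_cons_pairS.
Qed.

Lemma sqnorm_eq0_negligible n : {ae lebesgueN R n.+1, forall y, sqnorm y != 0}.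
Proof.
exists [set x | forall i, [set 0%R] (tnth x i)]; split.
- rewrite (_ : [set _ | _] = [set x | forall i, `[- 0, 0]%classic (tnth x i)]).
    exact: measurable_cube.
  by rewrite oppr0 set_itv1.
- rewrite (@lebesgueN_box R n.+1 (fun=> [set 0%R]))//.
  by rewrite big_ord_recl lebesgue_measure_set1 mul0e.
- move=> x /= /negP; rewrite negbK => /eqP.
  move=> x0 i; apply/eqP; rewrite -sqrf_eq0; move/eqP: x0.
  rewrite /sqnorm psumr_eq0 => [/allP /(_ i)|j _]; last exact: sqr_ge0.
  by rewrite mem_index_enum => /(_ isT).
Qed.

Lemma hermite_bound_inv_sqnorm n : (3 <= n)%N ->
  hermite_bound (@inv_sqnorm n) (128 * @hermite0sq R 0 ^+ 2).
Proof.
elim: n => // n IH; rewrite leq_eqVlt => /predU1P[[<-]|n3].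
  exact: hermite_bound_inv_sqnorm3.
case: n n3 IH => // n n3 IH.
apply: hermite_bound_cons (IH n3); [exact: measurable_inv_sqnorm|
  exact: inv_sqnorm_ge0|exact: measurable_inv_sqnorm|exact: inv_sqnorm_ge0|].
apply: (filterS _ (sqnorm_eq0_negligible n)) => y y0 z.
have yp : 0 < sqnorm y by rewrite lt_def y0 sqnorm_ge0.
rewrite /inv_sqnorm sqnorm_cons lef_pV2 ?posrE ?lerDr ?sqr_ge0//.
by rewrite ltr_wpDl// sqr_ge0.
Qed.

End averaging.

(** * The singular weights *)

Section singular_weight.
Context {R : realType}.

Definition singular_weight n (delta : R) (x : euclidean R n) : R :=
  (enorm x `^ delta)^-1.

Lemma singular_weight_ge0 n delta (x : euclidean R n) :
  0 <= singular_weight delta x.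
Proof. by rewrite invr_ge0 powR_ge0. Qed.

Lemma enorm_ge0 n (x : euclidean R n) : 0 <= enorm x.
Proof. exact: sqrtr_ge0. Qed.

Lemma sqr_enorm n (x : euclidean R n) : enorm x ^+ 2 = sqnorm x.
Proof. by rewrite sqr_sqrtr// sqnorm_ge0. Qed.

Lemma measurable_enorm n : measurable_fun setT (@enorm R n).
Proof.
have -> : @enorm R n = (fun x => sqnorm x `^ (2^-1)).
  by apply/funext => x; rewrite powR12_sqrt// sqnorm_ge0.
by apply: (@measurableT_comp _ _ _ _ _ _ (@powR R ^~ 2^-1));
  [exact: measurable_powR|exact: measurable_sqnorm].
Qed.

Lemma measurable_singular_weight n delta :
  measurable_fun setT (@singular_weight n delta).
Proof.
apply: measurable_funVge0; first by move=> x; exact: powR_ge0.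
by apply: (@measurableT_comp _ _ _ _ _ _ (@powR R ^~ delta));
  [exact: measurable_powR|exact: measurable_enorm].
Qed.

(* At the origin the weight is a junk value: 0 if delta <> 0, and 1 if delta = 0. *)
Lemma singular_weight0_le1 n delta (x : euclidean R n) :
  enorm x = 0 -> singular_weight delta x <= 1.
Proof.
rewrite /singular_weight => ->; have [->|d0] := eqVneq delta 0.
  by rewrite powRr0 invr1.
by rewrite powR0// invr0 ler01.
Qed.

Lemma singular_weight_far_le1 n delta (x : euclidean R n) :
  0 <= delta -> 1 <= enorm x -> singular_weight delta x <= 1.
Proof.
move=> d0 x1; have x0 : 0 < enorm x `^ delta by rewrite powR_gt0 ?(lt_le_trans ltr01).
by rewrite invf_le1// -(powRr0 (enorm x)) ler_powR.
Qed.

(** For 0 < |x| < 1 the exponent 2 delta may be raised to 2. The summand 1 covers |x| >= 1 and also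
    the origin, where [inv_sqnorm] is 0 but the weight may be 1. *)
Lemma sqr_singular_weight_le n delta (x : euclidean R n) : 0 <= delta <= 1 ->
  singular_weight delta x ^+ 2 <= 1 + inv_sqnorm x.
Proof.
move=> /andP[d0 d1]; have i0 := inv_sqnorm_ge0 x.
have w0 := singular_weight_ge0 delta x.
have [x1|x1] := leP 1 (enorm x).
  apply: (@le_trans _ _ 1); last by lra.
  by rewrite expr_le1// singular_weight_far_le1.
have [x0|x0] := eqVneq (enorm x) 0.
  apply: (@le_trans _ _ 1); last by lra.
  by rewrite expr_le1// singular_weight0_le1.
have xp : 0 < enorm x by rewrite lt_def x0 enorm_ge0.
rewrite /inv_sqnorm -sqr_enorm -exprVn.
apply: (@le_trans _ _ ((enorm x)^-1 ^+ 2)); last by rewrite lerDr.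
rewrite lerXn2r ?nnegrE ?singular_weight_ge0 ?invr_ge0 ?enorm_ge0//.
rewrite /singular_weight lef_pV2 ?posrE ?powR_gt0//.
rewrite -[leLHS]powRr1 ?enorm_ge0//; apply: ger_powR => //.
by rewrite xp ltW.
Qed.

Lemma hermite_bound_singular3 n delta : (3 <= n)%N -> 0 <= delta <= 1 ->
  hermite_bound (fun x : euclidean R n => singular_weight delta x ^+ 2)
    (1 + 128 * @hermite0sq R 0 ^+ 2).
Proof.
move=> n3 d01; apply: (hermite_boundD (w1 := fun=> 1) (w2 := @inv_sqnorm R n)) => //.
- by apply: measurable_funX; exact: measurable_singular_weight.
- by move=> x; exact: sqr_ge0.
- exact: measurable_inv_sqnorm.
- exact: inv_sqnorm_ge0.
- by move=> x; exact: sqr_singular_weight_le.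
- exact: hermite_bound1.
- exact: hermite_bound_inv_sqnorm.
Qed.

Definition in_cube n (r : R) (x : euclidean R n) : bool := [forall i, `|tnth x i| <= r].

Lemma in_cubeE n (r : R) : [set x : euclidean R n | in_cube r x] =
  [set x | forall i, `[- r, r]%classic (tnth x i)].
Proof.
apply/seteqP; split=> x /=.
  by move=> /forallP xr i; rewrite /= in_itv /= -ler_norml.
by move=> xr; apply/forallP => i; have := xr i; rewrite /= in_itv /= -ler_norml.
Qed.

Lemma notin_cube_enorm n (r : R) (x : euclidean R n) : 0 <= r ->
  ~~ in_cube r x -> r < enorm x.
Proof.
move=> r0; rewrite negb_forall => /existsP [i]; rewrite -ltNge => /lt_le_trans; apply.
rewrite -(@ler_pXn2r _ 2) ?nnegrE ?enorm_ge0// sqr_enorm real_normK ?num_real//.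
by rewrite /sqnorm (bigD1 i)//= lerDl; apply: sumr_ge0 => j _; exact: sqr_ge0.
Qed.

Let b (i : nat) : R := (2^-1) ^+ i.
Let b_gt0 i : 0 < b i. Proof. by rewrite exprn_gt0. Qed.

Definition cube_indic (i : nat) (x : euclidean R 2) : R := (in_cube (b i) x)%:R.

Lemma measurable_cube_indic i : measurable_fun setT (cube_indic i).
Proof.
have -> : cube_indic i = \1_[set x | in_cube (b i) x].
  apply/funext => x; rewrite /cube_indic indicE; congr (_%:R).
  by apply: congr1; apply/idP/idP; rewrite inE.
by apply: measurable_indic; rewrite in_cubeE; exact: measurable_cube.
Qed.

Lemma integral_cube_indic i :
  (\int[lebesgueN R 2]_x (cube_indic i x)%:E = (4 * b i ^+ 2)%:E)%E.
Proof.
have -> : cube_indic i = \1_[set x | in_cube (b i) x].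
  apply/funext => x; rewrite /cube_indic indicE; congr (_%:R).
  by apply: congr1; apply/idP/idP; rewrite inE.
rewrite integral_indic//; last by rewrite in_cubeE; exact: measurable_cube.
rewrite setIT in_cubeE [LHS]lebesgueN_cube ?(ltW (b_gt0 i))//.
by congr (_%:E); ring.
Qed.

Variable delta : R.
Hypothesis d01 : 0 <= delta < 1.

(* The contribution of the annulus between the cubes of sizes 2^-i and 2^-(i+1). *)
Let a (i : nat) : R := (b i.+1 `^ delta)^-1 ^+ 2.
Let a_ge0 i : 0 <= a i. Proof. exact: sqr_ge0. Qed.

Definition near_weight (x : euclidean R 2) : R :=
  singular_weight delta x ^+ 2 * cube_indic 0 x.

(** A single term of the series suffices: that of the last cube containing x, since x then lies
    outside the next cube and |x| > 2^-(j+1). The origin lies in all cubes, and there term 0 does,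
    because [a 0] is at least 1. *)
Lemma near_weight_le (x : euclidean R 2) :
  ((near_weight x)%:E <= \sum_(0 <= i <oo) (a i * cube_indic i x)%:E)%E.
Proof.
have /andP[d0 d1] := d01.
have s0 i : (0 <= (a i * cube_indic i x)%:E)%E by rewrite lee_fin mulr_ge0.
have one j : in_cube (b j) x -> singular_weight delta x ^+ 2 <= a j ->
    ((near_weight x)%:E <= \sum_(0 <= i <oo) (a i * cube_indic i x)%:E)%E.
  move=> xj wj; apply: (@le_trans _ _ (a j * cube_indic j x)%:E).
    rewrite lee_fin /near_weight {2}/cube_indic xj mulr1.
    by rewrite -[leRHS]mulr1 ler_pM ?sqr_ge0// /cube_indic; case: in_cube.
  apply: (@le_trans _ _ (\sum_(0 <= i < j.+1) (a i * cube_indic i x)%:E)%E).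
    by rewrite big_nat_recr//= leeDr// sume_ge0.
  exact: nneseries_lim_ge.
have [x0|x0] := boolP (in_cube (b 0) x); last first.
  rewrite /near_weight /cube_indic (negbTE x0) mulr0.
  by apply: nneseries_ge0 => i _ _; exact: s0.
have [e0|e0] := eqVneq (enorm x) 0.
  apply: (one 0) => //; apply: (@le_trans _ _ 1).
    by rewrite expr_le1 ?singular_weight_ge0// singular_weight0_le1.
  rewrite /a exprn_ege1// invf_ge1 ?powR_gt0//.
  rewrite -(powRr0 (b 1)); apply: ger_powR => //.
  by rewrite b_gt0 /b expr1; lra.
have ex : exists i, ~~ in_cube (b i.+1) x.
  have : ~ forall i, in_cube (b i.+1) x.
    move=> H; move/eqP: e0; apply.
    have xi i : tnth x i = 0.
      apply/eqP; rewrite -normr_le0; apply/ler_addgt0Pl => e e_gt0.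
      have := @cvg_geometric R 1 2^-1; rewrite ger0_norm// => /(_ ltac:(lra)).
      move=> /cvgrPdist_lt /(_ e e_gt0) [N _ /(_ N.+1)].
      rewrite /= mul1r sub0r normrN => /(_ (leqnSn N)) HN.
      rewrite addr0; apply: le_trans (forallP (H N) i) _.
      by rewrite ltW// (le_lt_trans (ler_norm _)).
    by rewrite /enorm big1 ?sqrtr0// => i _; rewrite xi expr0n.
  by move=> H; apply: contrapT => /forallNP H'; apply: H => i; apply/negPn/negP => /(H' i).
pose j := ex_minn ex; have [jN jmin] : ~~ in_cube (b j.+1) x /\
    forall m, ~~ in_cube (b m.+1) x -> (j <= m)%N.
  by rewrite /j; case: ex_minnP.
apply: (one j).
  case: (j) jmin => // m mm; apply/negPn/negP => /mm.
  by rewrite ltnn.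
have := notin_cube_enorm (ltW (b_gt0 _)) jN => bj.
rewrite lerXn2r ?nnegrE ?singular_weight_ge0 ?invr_ge0 ?powR_ge0//.
have ep : 0 < enorm x by rewrite (lt_trans (b_gt0 _) bj).
rewrite /singular_weight lef_pV2 ?posrE ?powR_gt0//.
by rewrite ge0_ler_powR ?nnegrE ?(ltW ep) ?(ltW bj) ?(ltW (b_gt0 _)).
Qed.

Lemma integral_near_weight : exists2 U : R, 0 <= U &
  (\int[lebesgueN R 2]_x (near_weight x)%:E <= U%:E)%E.
Proof.
have /andP[d0 d1] := d01.
have sw0 i x : (0 <= (a i * cube_indic i x)%:E)%E.
  by rewrite lee_fin mulr_ge0// /cube_indic; case: in_cube.
pose be : R := 2^-1 `^ delta.
have be0 : 0 < be by rewrite powR_gt0.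
have be2 : 2^-1 < be.
  rewrite -[ltLHS]powRr1// /be /powR gt_eqF// ltr_expR ltr_nM2r// ln_lt0//.
  by apply/andP; split; lra.
(* The ratio of the geometric series is 4^(delta-1): a cube of area 4 * 4^-i against a weight
   4^(delta (i+1)). It is below 1 because delta < 1. *)
pose z : R := (2^-1 * be^-1) ^+ 2.
have z0 : 0 < z by rewrite exprn_gt0// mulr_gt0// invr_gt0.
have z1 : z < 1.
  rewrite /z exprn_ilt1//; first by rewrite mulr_ge0 ?invr_ge0 ?ltW.
  by rewrite ltr_pdivrMr// mul1r.
pose A : R := 4 * be^-1 ^+ 2.
have A0 : 0 <= A by rewrite mulr_ge0 ?sqr_ge0.
have term i : a i * (4 * b i ^+ 2) = A * z ^+ i.
  rewrite /a /b /A /z.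
  have -> : (2^-1 ^+ i.+1) `^ delta = be ^+ i.+1.
    rewrite -[2^-1 ^+ i.+1]powR_mulrn ?invr_ge0// -powRrM mulrC powRrM.
    by rewrite powR_mulrn ?powR_ge0.
  rewrite -exprVn [be^-1 ^+ i.+1]exprS -[in RHS]exprM mulnC exprM [in RHS]exprMn.
  by move: (be^-1 ^+ i) (2^-1 ^+ i) => u v; ring.
exists (A * (1 - z)^-1); first by rewrite mulr_ge0// invr_ge0 subr_ge0 ltW.
apply: (@le_trans _ _ (\int[lebesgueN R 2]_x
    \sum_(0 <= i <oo) (a i * cube_indic i x)%:E)%E).
  apply: ge0_le_integral => //.
  - by move=> x _; rewrite lee_fin mulr_ge0 ?sqr_ge0// /cube_indic; case: in_cube.
  - apply/measurable_EFinP; apply: measurable_funM.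
      by apply: measurable_funX; exact: measurable_singular_weight.
    exact: measurable_cube_indic.
  - apply: ge0_emeasurable_sum => // i _.
    by apply/measurable_EFinP; apply: measurable_funM => //; exact: measurable_cube_indic.
  - by move=> x _; exact: near_weight_le.
rewrite integral_nneseries//; last first.
  by move=> i; apply/measurable_EFinP; apply: measurable_funM => //; exact: measurable_cube_indic.
have E i : (\int[lebesgueN R 2]_x (a i * cube_indic i x)%:E = (A * z ^+ i)%:E)%E.
  under eq_integral do rewrite EFinM.
  rewrite ge0_integralZl//.
  - by rewrite integral_cube_indic -EFinM term.
  - by apply/measurable_EFinP; exact: measurable_cube_indic.
  - by move=> x _; rewrite lee_fin /cube_indic; case: in_cube.
  - by rewrite lee_fin.
under eq_eseriesr do rewrite E.
apply: lime_le.
  by apply: is_cvg_nneseries => i _ _; rewrite lee_fin mulr_ge0// exprn_ge0// ltW.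
apply: nearW => m; rewrite sumEFin lee_fin.
apply: (geometric_le_lim m A0 z0).
by rewrite ger0_norm// ltW.
Qed.

(** Cauchy-Schwarz with an upper bound P in place of one square sum: expand the squares of P c_i - S
    H_i, where S is the sum to be bounded. Applied to values at a point, it makes the diagonal of
    the kernel control the combination there. *)
Lemma sqr_sum_le (I : Type) (r : seq I) (c H : I -> R) (P : R) : 0 < P ->
  \sum_(i <- r) H i ^+ 2 <= P ->
  (\sum_(i <- r) c i * H i) ^+ 2 <= P * \sum_(i <- r) c i ^+ 2.
Proof.
move=> P0 HP.
have E (T : R) : \sum_(i <- r) (P * c i - T * H i) ^+ 2 =
   P ^+ 2 * (\sum_(i <- r) c i ^+ 2) - 2 * P * T * (\sum_(i <- r) c i * H i) +
   T ^+ 2 * \sum_(i <- r) H i ^+ 2.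
  by rewrite !mulr_sumr -sumrB -big_split; apply: eq_bigr => i _ /=; ring.
set S := \sum_(i <- r) c i * H i.
have : 0 <= \sum_(i <- r) (P * c i - S * H i) ^+ 2.
  by apply: sumr_ge0 => i _; exact: sqr_ge0.
rewrite E -/S.
have : S ^+ 2 * \sum_(i <- r) H i ^+ 2 <= S ^+ 2 * P by rewrite ler_wpM2l// sqr_ge0.
move: (\sum_(i <- r) H i ^+ 2) (\sum_(i <- r) c i ^+ 2) => B C h1 h2.
rewrite -(ler_pM2l P0).
have -> : P * (P * C) = P ^+ 2 * C by ring.
nra.
Qed.

Lemma sqr_hermite_comb2_le k c (x : euclidean R 2) : in_cube 1 x ->
  hermite_comb k c x ^+ 2 <=
  9 * @hermite0sq R 0 ^+ 2 * \sum_(s <- comps 2 k) c s ^+ 2.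
Proof.
move=> /forallP x1; apply: sqr_sum_le.
  rewrite mulr_gt0// exprn_gt0// /hermite0sq hermite_funE hornerC.
  by rewrite exprn_gt0// !mulr_gt0 ?expR_gt0 ?hermite_coef_gt0.
rewrite big_comps2.
apply: le_trans (convol_hermite_near0_le k (x1 ord0) (x1 (lift ord0 ord0))).
apply: ler_sum => i _.
by rewrite /hermite_seq !big_ord_recl big_ord0 mulr1 exprMn.
Qed.

Lemma hermite_bound_singular2 : exists2 C : R, 0 < C &
  hermite_bound (fun x : euclidean R 2 => singular_weight delta x ^+ 2) C.
Proof.
have /andP[d0 d1] := d01.
have nw0 x : 0 <= near_weight x.
  by rewrite mulr_ge0 ?sqr_ge0// /cube_indic; case: in_cube.
have mnw : measurable_fun setT near_weight.
  apply: measurable_funM; last exact: measurable_cube_indic.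
  by apply: measurable_funX; exact: measurable_singular_weight.
have [U U0 HU] := integral_near_weight.
pose P : R := 9 * hermite0sq 0 ^+ 2.
have P0 : 0 <= P by rewrite mulr_ge0 ?sqr_ge0.
exists (1 + P * U); first by rewrite ltr_wpDr// mulr_ge0.
apply: (hermite_boundD (w1 := fun=> 1) (w2 := near_weight)) => //.
- by apply: measurable_funX; exact: measurable_singular_weight.
- by move=> x; exact: sqr_ge0.
- move=> x; rewrite /near_weight /cube_indic.
  have [xb|xb] := boolP (in_cube (b 0) x); first by rewrite mulr1 lerDr.
  rewrite mulr0 addr0 expr_le1 ?singular_weight_ge0//.
  apply: singular_weight_far_le1 => //; apply: ltW.
  by have := notin_cube_enorm (ltW (b_gt0 0)) xb; rewrite /b expr0.
- exact: hermite_bound1.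
move=> k c; set S := \sum_(s <- _) _.
have S0 : 0 <= S by apply: sumr_ge0 => s _; exact: sqr_ge0.
apply: (@le_trans _ _ (\int[lebesgueN R 2]_x ((P * S)%:E * (near_weight x)%:E))%E).
  apply: ge0_le_integral => //.
  - by move=> x _; rewrite lee_fin mulr_ge0 ?sqr_ge0.
  - exact: measurable_hermite_comb_w.
  - by apply: measurable_funeM; exact/measurable_EFinP.
  move=> x _; rewrite -EFinM lee_fin.
  have [xb|xb] := boolP (in_cube (b 0) x).
    by rewrite ler_wpM2r//; apply: sqr_hermite_comb2_le; move: xb; rewrite /b expr0.
  by rewrite /near_weight /cube_indic (negbTE xb) !mulr0.
rewrite ge0_integralZl//.
- apply: (@le_trans _ _ ((P * S)%:E * U%:E)%E).
    by rewrite lee_wpmul2l// lee_fin mulr_ge0.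
  by rewrite -EFinM lee_fin le_eqVlt; apply/orP; left; apply/eqP; ring.
- exact/measurable_EFinP.
- by move=> x _; rewrite lee_fin.
- by rewrite lee_fin mulr_ge0.
Qed.

End singular_weight.

(** * The projection kernels *)

Section hermite_kernel_sum.
Context {R : realType}.

Let seq_of n k (a : {ffun 'I_n -> 'I_k.+1}) : seq nat :=
  [seq nat_of_ord (a i) | i <- enum 'I_n].

Let nth_seq_of n k (a : {ffun 'I_n -> 'I_k.+1}) (i : 'I_n) :
  nth 0 (seq_of a) i = a i.
Proof. by rewrite (nth_map i) ?size_enum_ord// nth_ord_enum. Qed.

(** Links the two encodings of multiindices; an entry of a list with sum k is at most k, so it fits
    in ['I_k.+1]. *)
Lemma sum_ffun_comps n k (F : seq nat -> R) :
  \sum_(a : {ffun 'I_n -> 'I_k.+1} | (\sum_(i < n) a i)%N == k) F (seq_of a) =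
  \sum_(s <- comps n k) F s.
Proof.
rewrite -big_filter -(big_map (@seq_of n k) predT F).
apply: perm_big; apply: uniq_perm; [|exact: uniq_comps|].
  rewrite map_inj_uniq ?filter_uniq ?index_enum_uniq// => a b ab.
  by apply/ffunP => i; apply: ord_inj; rewrite -!nth_seq_of ab.
have sumE (a : {ffun 'I_n -> 'I_k.+1}) :
    sumn (seq_of a) = (\sum_(i < n) a i)%N.
  by rewrite sumnE big_map big_enum.
move=> s; rewrite mem_comps; apply/mapP/andP => [[a]|[/eqP ss /eqP sk]].
  rewrite mem_filter => /andP[/= ak _] ->.
  by rewrite size_map size_enum_ord sumE.
have sik (i : 'I_n) : (nth 0 s i < k.+1)%N.
  by rewrite ltnS -sk sumnE (big_nth 0) ss big_mkord (bigD1 i)//= leq_addr.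
exists [ffun i => Ordinal (sik i)]; last first.
  apply: (@eq_from_nth _ 0); first by rewrite size_map size_enum_ord.
  by move=> i; rewrite ss => i_n; rewrite (nth_seq_of _ (Ordinal i_n)) ffunE.
rewrite mem_filter mem_index_enum andbT /=.
apply/eqP; rewrite -[RHS]sk sumnE (big_nth 0) ss big_mkord.
by apply: eq_bigr => i _; rewrite ffunE.
Qed.

Lemma hermite_kernelE n k (x y : euclidean R n) :
  hermite_kernel k x y =
  \sum_(s <- comps n k) hermite_seq s x * hermite_seq s y.
Proof.
rewrite /hermite_kernel -(sum_ffun_comps n k (fun s => hermite_seq s x * hermite_seq s y)).
apply: eq_bigr => a _; rewrite /hermite_multi /hermite_seq.
by congr (_ * _); apply: eq_bigr => i _; rewrite (nth_seq_of a i).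
Qed.

End hermite_kernel_sum.

(** * Kernels weighted on both sides as operators on L^2 *)

Section weighted_kernel.
Context {R : realType} {n : nat}.
Let nu := lebesgueN R n.
Implicit Types (f g w : euclidean R n -> R) (c : seq nat -> R).

Definition square_integrable f := measurable_fun setT f /\
  (\int[nu]_x (f x ^+ 2)%:E < +oo)%E.

Lemma integrable_sqr f : square_integrable f ->
  nu.-integrable setT (fun x => (f x ^+ 2)%:E).
Proof.
move=> [mf foo]; apply/integrableP; split.
  by apply/measurable_EFinP; exact: measurable_funX.
by under eq_integral do rewrite /= ger0_norm ?sqr_ge0//.
Qed.

Lemma square_integrableM f g : square_integrable f -> square_integrable g ->
  nu.-integrable setT (fun x => (f x * g x)%:E).
Proof.
move=> sf sg.
have := integrableD measurableT (integrable_sqr sf) (integrable_sqr sg).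
apply: le_integrable => //.
  by apply/measurable_EFinP; apply: measurable_funM; [exact: sf.1|exact: sg.1].
move=> x _ /=; rewrite lee_fin [leRHS]ger0_norm; last first.
  by rewrite addr_ge0// sqr_ge0.
rewrite normrM -(real_normK (num_real (f x))) -(real_normK (num_real (g x))).
have := normr_ge0 (f x); have := normr_ge0 (g x); have := sqr_ge0 (`|f x| - `|g x|); nra.
Qed.

Variables (w1 w2 : euclidean R n -> R) (C1 C2 : R).
Hypothesis mw1 : measurable_fun setT w1.
Hypothesis mw2 : measurable_fun setT w2.
Hypothesis C1_gt0 : 0 < C1.
Hypothesis C2_gt0 : 0 < C2.
Hypothesis Hw1 : hermite_bound (fun x => w1 x ^+ 2) C1.
Hypothesis Hw2 : hermite_bound (fun x => w2 x ^+ 2) C2.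

Lemma square_integrable_hermite_comb k c w C :
  measurable_fun setT w -> hermite_bound (fun x => w x ^+ 2) C ->
  square_integrable (fun x => hermite_comb k c x * w x).
Proof.
move=> mw Hw; split.
  by apply: measurable_funM => //; exact: measurable_hermite_comb.
apply: (@le_lt_trans _ _ (C * \sum_(s <- comps n k) c s ^+ 2)%:E); last exact: ltry.
by apply: le_trans (Hw k c); under eq_integral do rewrite exprMn.
Qed.


(** A combination with a single nonzero coefficient. The list s has arbitrary length, whereas
    [comps] holds lists of length n; [mkseq] pads or truncates it to the same function. *)
Lemma square_integrable_hermite_seq w C s :
  measurable_fun setT w -> hermite_bound (fun x => w x ^+ 2) C ->
  square_integrable (fun x => hermite_seq s x * w x).
Proof.
move=> mw Hw; pose t := mkseq (nth 0 s) n.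
have tn : size t = n by rewrite size_mkseq.
have := square_integrable_hermite_comb (sumn t) (fun u => (u == t)%:R) mw Hw.
congr square_integrable; apply/funext => x; congr (_ * _).
rewrite /hermite_comb (bigD1_seq t) ?uniq_comps ?mem_comps ?tn ?eqxx//=.
rewrite mul1r big1 ?addr0; last by move=> u /negbTE ->; rewrite mul0r.
by apply: eq_bigr => i _; rewrite nth_mkseq.
Qed.

Lemma Rintegral_sumZl (I : Type) (r : seq I) (c : I -> R)
    (h : I -> euclidean R n -> R) :
  (forall i, nu.-integrable setT (EFin \o h i)) ->
  nu.-integrable setT (EFin \o (fun x => \sum_(i <- r) c i * h i x)) /\
  (\int[nu]_x (\sum_(i <- r) c i * h i x) = \sum_(i <- r) c i * \int[nu]_x h i x)%R.
Proof.
move=> ih.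
have iz i : nu.-integrable setT (EFin \o (fun x => c i * h i x)).
  by have := integrableZl measurableT (c i) (ih i); apply: eq_integrable.
elim: r => [|i r [IH1 IH2]].
  rewrite big_nil; split.
    have := @integrable0 _ _ _ nu setT; apply: eq_integrable => // x _ /=.
    by rewrite big_nil.
  transitivity (\int[nu]_x (0 : R))%R.
    by apply: eq_Rintegral => x _; rewrite big_nil.
  by rewrite Rintegral_cst// mul0r.
rewrite big_cons -IH2 -RintegralZl// -RintegralD//.
split; last by apply: eq_Rintegral => x _; rewrite big_cons.
have := integrableD measurableT (iz i) IH1; apply: eq_integrable => // x _ /=.
by rewrite big_cons.
Qed.

Section weighted_coefficients.
Variables (k : nat) (f : euclidean R n -> R).
Hypothesis sf : square_integrable f.

(** The coefficients of P_k (w2 f); the operator sends f to the combination with these coefficients,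
    times w1. *)
Definition weighted_coef s : R :=
  (\int[nu]_y (hermite_seq s y * w2 y * f y))%R.
Local Notation a := weighted_coef.

Let integrable_coef s :
  nu.-integrable setT (EFin \o (fun y => hermite_seq s y * w2 y * f y)).
Proof.
by apply: square_integrableM => //; exact: square_integrable_hermite_seq mw2 Hw2.
Qed.

Let kernelE x y : hermite_kernel k x y * w1 x * w2 y * f y =
  \sum_(s <- comps n k) (w1 x * hermite_seq s x) * (hermite_seq s y * w2 y * f y).
Proof. by rewrite hermite_kernelE !mulr_suml; apply: eq_bigr => s _; ring. Qed.

Lemma integrable_weighted_kernel x :
  nu.-integrable setT (fun y => (hermite_kernel k x y * w1 x * w2 y * f y)%:E).
Proof.
have [+ _] := Rintegral_sumZl (comps n k) (fun s => w1 x * hermite_seq s x) integrable_coef.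
by apply: eq_integrable => // y _ /=; rewrite kernelE.
Qed.

Lemma Rintegral_weighted_kernel x :
  (\int[nu]_y (hermite_kernel k x y * w1 x * w2 y * f y))%R =
  hermite_comb k a x * w1 x.
Proof.
have [_ +] := Rintegral_sumZl (comps n k) (fun s => w1 x * hermite_seq s x) integrable_coef.
under eq_Rintegral do rewrite -kernelE.
by move=> ->; rewrite /hermite_comb mulr_suml; apply: eq_bigr => s _; rewrite /a; ring.
Qed.

(* Duality: the square sum S of the coefficients is the integral of f against
   g w2, where g is the combination with these very coefficients, whose square
   norm is at most C2 S. *)
Lemma weighted_bessel :
  ((\sum_(s <- comps n k) a s ^+ 2)%:E <= C2%:E * \int[nu]_x (f x ^+ 2)%:E)%E.
Proof.
pose g x := hermite_comb k a x * w2 x.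
have sg : square_integrable g by exact: square_integrable_hermite_comb mw2 Hw2.
set A := \sum_(s <- _) _.
have fgA : (\int[nu]_x (g x * f x))%R = A.
  have [_ +] := Rintegral_sumZl (comps n k) a integrable_coef.
  rewrite /A; under [X in _ = X -> _]eq_bigr do rewrite -/(a _) -expr2.
  move=> <-; apply: eq_Rintegral => x _.
  by rewrite /g /hermite_comb !mulr_suml; apply: eq_bigr => s _; rewrite !mulrA.
have If := integrable_sqr sf; have Ig := integrable_sqr sg.
have Igf := square_integrableM sg sf.
have fE : (\int[nu]_x (f x ^+ 2)%:E = (\int[nu]_x (f x ^+ 2))%R%:E)%E.
  by rewrite /Rintegral fineK//; exact: integrable_fin_num.
have gE : (\int[nu]_x (g x ^+ 2) <= C2 * A)%R.
  rewrite -lee_fin /Rintegral fineK; last exact: integrable_fin_num.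
  by apply: le_trans (Hw2 k a); under eq_integral do rewrite exprMn.
(* The expansion is C2^2 |f|^2 - 2 C2 A + |g|^2, and |g|^2 <= C2 A leaves A <= C2 |f|^2. *)
have : 0 <= (\int[nu]_x ((C2 * f x - g x) ^+ 2))%R.
  by apply: Rintegral_ge0 => x _; exact: sqr_ge0.
have iz (c : R) (h : euclidean R n -> R) : nu.-integrable setT (EFin \o h) ->
    nu.-integrable setT (EFin \o (fun x => c * h x)).
  by move=> ih; have := integrableZl measurableT c ih; apply: eq_integrable.
have -> : (\int[nu]_x ((C2 * f x - g x) ^+ 2))%R =
    (\int[nu]_x (C2 ^+ 2 * (f x ^+ 2) + ((- (2 * C2)) * (g x * f x) + g x ^+ 2)))%R.
  by apply: eq_Rintegral => x _; ring.
have i2 : nu.-integrable setT (EFin \o (fun x => (- (2 * C2)) * (g x * f x) + g x ^+ 2)).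
  by have := integrableD measurableT (iz (- (2 * C2)) _ Igf) Ig; apply: eq_integrable.
rewrite RintegralD//; last exact: iz.
rewrite RintegralD//; last exact: iz.
rewrite !RintegralZl// fgA fE -EFinM lee_fin.
move: gE; move: (\int[nu]_x (g x ^+ 2))%R (\int[nu]_x (f x ^+ 2))%R => G F GA H.
by rewrite -(ler_pM2l C2_gt0); nra.
Qed.

Lemma weighted_kernel_bound :
  (\int[nu]_x ((hermite_comb k a x * w1 x) ^+ 2)%:E <=
   (C1 * C2)%:E * \int[nu]_x (f x ^+ 2)%:E)%E.
Proof.
under eq_integral do rewrite exprMn.
apply: le_trans (Hw1 k a) _; rewrite !EFinM -muleA lee_pmul2l ?lte_fin//.
exact: weighted_bessel.
Qed.

End weighted_coefficients.

Lemma L2normE (f : euclidean R n -> complex.complex R) :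
  L2norm f = ((\int[nu]_x (complex.Re (f x) ^+ 2 + complex.Im (f x) ^+ 2)%:E)
    `^ 2^-1)%E.
Proof.
rewrite /L2norm unlock; congr (poweR _ _); apply: eq_integral => x _.
case: (f x) => u v /=.
have uv0 : 0 <= u ^+ 2 + v ^+ 2 by rewrite addr_ge0// sqr_ge0.
by rewrite ger0_norm ?sqrtr_ge0// powR_mulrn ?sqrtr_ge0// sqr_sqrtr.
Qed.

Lemma integral_sqrD f g : measurable_fun setT f -> measurable_fun setT g ->
  (\int[nu]_x (f x ^+ 2 + g x ^+ 2)%:E =
   \int[nu]_x (f x ^+ 2)%:E + \int[nu]_x (g x ^+ 2)%:E)%E.
Proof.
move=> mf mg; rewrite -ge0_integralD//.
- by move=> x _; rewrite lee_fin sqr_ge0.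
- by apply/measurable_EFinP; exact: measurable_funX.
- by move=> x _; rewrite lee_fin sqr_ge0.
- by apply/measurable_EFinP; exact: measurable_funX.
Qed.

Lemma L2P (f : euclidean R n -> complex.complex R) : L2 f <->
  square_integrable (fun x => complex.Re (f x)) /\
  square_integrable (fun x => complex.Im (f x)).
Proof.
split=> [[mr mi]|[[mr fr] [mi fi]]].
  rewrite L2normE => /lty_poweRy; rewrite invr_eq0 pnatr_eq0 => /(_ isT).
  rewrite integral_sqrD// => foo.
  by split; split=> //; apply: le_lt_trans foo; rewrite ?leeDl ?leeDr//;
    apply: integral_ge0 => x _; rewrite lee_fin sqr_ge0.
split=> //; rewrite L2normE; apply: poweR_lty.
by rewrite integral_sqrD//; exact: lte_add_pinfty.
Qed.

(** One factor sqrt C1 comes from the estimate on the range of P_k, the other from its dual form for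
    w2. The kernel is real, so the squared norms of real and imaginary parts are bounded separately
    and added. *)
Lemma weighted_hermite_L2_bounded k :
  L2_bounded_by (fun x y => hermite_kernel k x y * w1 x * w2 y)
    (Num.sqrt (C1 * C2)).
Proof.
move=> f f2; have /L2P[sr si] := f2.
pose F1 := fun x => hermite_comb k (weighted_coef (fun x => complex.Re (f x))) x * w1 x.
pose F2 := fun x => hermite_comb k (weighted_coef (fun x => complex.Im (f x))) x * w1 x.
have KE : kernel_op (fun x y => hermite_kernel k x y * w1 x * w2 y) f =
    (fun x => complex.Complex (F1 x) (F2 x)).
  by apply/funext => x; rewrite /kernel_op !Rintegral_weighted_kernel.
split.
- by apply: aeW => x; split; exact: integrable_weighted_kernel.
- by rewrite KE; apply/L2P; split; exact: square_integrable_hermite_comb mw1 Hw1.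
have mc c : measurable_fun setT (fun x => hermite_comb k c x * w1 x).
  by apply: measurable_funM => //; exact: measurable_hermite_comb.
rewrite KE !L2normE /=.
have C0 : 0 <= C1 * C2 by rewrite mulr_ge0 ?ltW.
have -> : (Num.sqrt (C1 * C2))%:E = ((C1 * C2)%:E `^ 2^-1)%E.
  by rewrite poweR_EFin powR12_sqrt.
have sum0 (u v : euclidean R n -> R) : (0 <= \int[nu]_x (u x ^+ 2 + v x ^+ 2)%:E)%E.
  by apply: integral_ge0 => x _; rewrite lee_fin addr_ge0// sqr_ge0.
rewrite -poweRM ?lee_fin//.
apply: gt0_ler_poweR; rewrite ?invr_ge0//.
- by rewrite in_itv /= leey sum0.
- by rewrite in_itv /= leey mule_ge0 ?lee_fin.
have [mr _] := sr; have [mi _] := si.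
rewrite !integral_sqrD//; try exact: mc.
rewrite ge0_muleDr; [|by apply: integral_ge0 => x _; rewrite lee_fin sqr_ge0..].
by apply: leeD; exact: weighted_kernel_bound.
Qed.

End weighted_kernel.

Theorem theorem6 (R : realType) (n : nat) (delta : R)
  (hn : ((3 <= n)%N /\ 0 <= delta <= 1) \/ (n = 2%N /\ 0 <= delta < 1)) :
  uniformly_L2_bounded (fun k (x y : euclidean R n) =>
    hermite_kernel k x y / enorm x `^ delta) /\
  uniformly_L2_bounded (fun k (x y : euclidean R n) =>
    hermite_kernel k x y / (enorm x `^ delta * enorm y `^ delta)).
Proof.
pose w (x : euclidean R n) := singular_weight delta x.
have [C C0 HC] : exists2 C : R, 0 < C & hermite_bound (fun x => w x ^+ 2) C.
  rewrite /w; case: hn => [[n3 d]|[-> d]]; last exact: hermite_bound_singular2.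
  exists (1 + 128 * hermite0sq 0 ^+ 2); last exact: hermite_bound_singular3.
  by rewrite ltr_wpDr// mulr_ge0 ?sqr_ge0.
have mw : measurable_fun setT w by exact: measurable_singular_weight.
(* The first family has weight 1 in y, the second the singular weight on both sides; both are
   instances of the two-weight bound. *)
have H1 : hermite_bound (fun x : euclidean R n => 1 ^+ 2) 1.
  by rewrite expr1n; exact: hermite_bound1.
split.
- exists (Num.sqrt (C * 1)) => [|k]; first by rewrite sqrtr_gt0 mulr1.
  have := @weighted_hermite_L2_bounded R n w (fun=> 1) C 1 mw (measurable_cst _)
    C0 ltr01 HC H1 k.
  by congr L2_bounded_by; apply/funext => x; apply/funext => y; rewrite mulr1.
- exists (Num.sqrt (C * C)) => [|k]; first by rewrite sqrtr_gt0 mulr_gt0.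
  have := @weighted_hermite_L2_bounded R n w w C C mw mw C0 C0 HC HC k.
  congr L2_bounded_by; apply/funext => x; apply/funext => y.
  by rewrite /w /singular_weight invfM mulrA.
Qed.
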